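(* Let $(X,\langle\cdot,\cdot\rangle)$ be an infinite-dimensional real Hilbert space and let $J:X\to\mathbb{R}$ be a functional of class $C^2$ whose derivative $J':X\to X$ is a compact operator. For each $\lambda\in\mathbb{R}$ put $$A_\lambda=\{x\in X:\ y=\lambda J''(x)(y)\ \text{for some } y\in X\setminus\{0\}\}.$$ Put $$M=\max\left\{0,\ 2\limsup_{\|x\|\to+\infty}\frac{J(x)}{\|x\|^2},\ \limsup_{\|x\|\to+\infty}\frac{\langle J'(x),x\rangle}{\|x\|^2}\right\}$$ and assume $$M<\sup_{(x,y)\in X\times(X\setminus\{0\})}\frac{\langle J''(x)(y),y\rangle}{\|y\|^2}.$$ Then for every $\lambda$ satisfying $$\inf_{\{(x,y)\in X\times X:\ \langle J''(x)(y),y\rangle>0\}}\frac{\|y\|^2}{\langle J''(x)(y),y\rangle}<\lambda<\frac1M,$$ the set $A_\lambda$ is closed and not $\sigma$-compact in $X$.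
   Context: $J'(x)\in X$ is identified with the gradient via the Riesz representation, and $J''(x)$ is a bounded linear operator $X\to X$. A compact operator here means a continuous map sending bounded sets to relatively compact sets. Convention: $\frac10=+\infty$. A set in a topological space is $\sigma$-compact if it is the union of an at most countable family of compact sets. *)

(* Defs.v *)
From Stdlib Require Import Reals List.
Open Scope R_scope.

Record HilbertSpace := {
  hs_car :> Type;
  hs_zero : hs_car;
  hs_add : hs_car -> hs_car -> hs_car;
  hs_opp : hs_car -> hs_car;
  hs_scal : R -> hs_car -> hs_car;
  hs_inner : hs_car -> hs_car -> R;
  hs_add_assoc : forall x y z, hs_add x (hs_add y z) = hs_add (hs_add x y) z;
  hs_add_comm : forall x y, hs_add x y = hs_add y x;
  hs_add_zero : forall x, hs_add x hs_zero = x;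
  hs_add_opp : forall x, hs_add x (hs_opp x) = hs_zero;
  hs_scal_one : forall x, hs_scal 1 x = x;
  hs_scal_assoc : forall a b x, hs_scal a (hs_scal b x) = hs_scal (a * b) x;
  hs_scal_distr_l : forall a x y, hs_scal a (hs_add x y) = hs_add (hs_scal a x) (hs_scal a y);
  hs_scal_distr_r : forall a b x, hs_scal (a + b) x = hs_add (hs_scal a x) (hs_scal b x);
  hs_inner_sym : forall x y, hs_inner x y = hs_inner y x;
  hs_inner_add : forall x y z, hs_inner (hs_add x y) z = hs_inner x z + hs_inner y z;
  hs_inner_scal : forall a x y, hs_inner (hs_scal a x) y = a * hs_inner x y;
  hs_inner_pos : forall x, 0 <= hs_inner x x;
  hs_inner_def : forall x, hs_inner x x = 0 -> x = hs_zero;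
  hs_complete : forall u : nat -> hs_car,
    (forall eps, 0 < eps -> exists N, forall m n, (N <= m)%nat -> (N <= n)%nat ->
        sqrt (hs_inner (hs_add (u m) (hs_opp (u n))) (hs_add (u m) (hs_opp (u n)))) < eps) ->
    exists l, forall eps, 0 < eps -> exists N, forall n, (N <= n)%nat ->
        sqrt (hs_inner (hs_add (u n) (hs_opp l)) (hs_add (u n) (hs_opp l))) < eps
}.

Section Defs.
Variable X : HilbertSpace.

Definition hsub (x y : X) : X := hs_add X x (hs_opp X y).
Definition hnorm (x : X) : R := sqrt (hs_inner X x x).

Fixpoint lin_comb (c : nat -> R) (v : nat -> X) (n : nat) : X :=
  match n with
  | O => hs_zero X
  | S k => hs_add X (lin_comb c v k) (hs_scal X (c k) (v k))
  end.

Definition infinite_dim : Prop :=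
  forall n : nat, exists v : nat -> X,
    forall c : nat -> R, lin_comb c v n = hs_zero X -> forall i, (i < n)%nat -> c i = 0.

Definition is_open (U : X -> Prop) : Prop :=
  forall x, U x -> exists e, 0 < e /\ forall y, hnorm (hsub y x) < e -> U y.
Definition is_closed (F : X -> Prop) : Prop := is_open (fun x => ~ F x).
Definition is_compact (K : X -> Prop) : Prop :=
  forall (I : Type) (U : I -> X -> Prop),
    (forall i, is_open (U i)) -> (forall x, K x -> exists i, U i x) ->
    exists l : list I, forall x, K x -> exists i, In i l /\ U i x.
Definition closure (S : X -> Prop) : X -> Prop :=
  fun x => forall e, 0 < e -> exists y, S y /\ hnorm (hsub y x) < e.
Definition rel_compact (S : X -> Prop) : Prop := is_compact (closure S).
Definition is_bounded (S : X -> Prop) : Prop := exists r, forall x, S x -> hnorm x <= r.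
Definition image (f : X -> X) (S : X -> Prop) : X -> Prop :=
  fun y => exists x, S x /\ f x = y.
Definition continuous_map (f : X -> X) : Prop :=
  forall x eps, 0 < eps -> exists d, 0 < d /\
    forall z, hnorm (hsub z x) < d -> hnorm (hsub (f z) (f x)) < eps.
Definition compact_operator (f : X -> X) : Prop :=
  continuous_map f /\ forall S, is_bounded S -> rel_compact (image f S).
(* sigma-compact: union of an at most countable family of compact sets
   (a finite or empty family is padded with empty sets, which are compact) *)
Definition sigma_compact (A : X -> Prop) : Prop :=
  exists K : nat -> X -> Prop, (forall n, is_compact (K n)) /\
    forall x, A x <-> exists n, K n x.

Definition bounded_linear (T : X -> X) : Prop :=
  (forall x y, T (hs_add X x y) = hs_add X (T x) (T y)) /\
  (forall a x, T (hs_scal X a x) = hs_scal X a (T x)) /\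
  (exists C, forall y, hnorm (T y) <= C * hnorm y).

Definition is_C2 (J : X -> R) (J' : X -> X) (J'' : X -> X -> X) : Prop :=
  (forall x eps, 0 < eps -> exists d, 0 < d /\ forall h, hnorm h < d ->
     Rabs (J (hs_add X x h) - J x - hs_inner X (J' x) h) <= eps * hnorm h) /\
  (forall x, bounded_linear (J'' x)) /\
  (forall x eps, 0 < eps -> exists d, 0 < d /\ forall h, hnorm h < d ->
     hnorm (hsub (hsub (J' (hs_add X x h)) (J' x)) (J'' x h)) <= eps * hnorm h) /\
  (forall x eps, 0 < eps -> exists d, 0 < d /\ forall z, hnorm (hsub z x) < d ->
     forall y, hnorm (hsub (J'' z y) (J'' x y)) <= eps * hnorm y).

(* (limsup_{||x||->+oo} f x) < c, in the extended-real sense *)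
Definition limsup_infty_lt (f : X -> R) (c : R) : Prop :=
  exists c', c' < c /\ exists r, forall x, r < hnorm x -> f x <= c'.

(* M < c, where M = max{0, 2 limsup J/||x||^2, limsup <J'x,x>/||x||^2} *)
Definition M_lt (J : X -> R) (J' : X -> X) (c : R) : Prop :=
  0 < c /\
  limsup_infty_lt (fun x => 2 * (J x / (hnorm x) ^ 2)) c /\
  limsup_infty_lt (fun x => hs_inner X (J' x) x / (hnorm x) ^ 2) c.

Definition A_set (J'' : X -> X -> X) (lam : R) : X -> Prop :=
  fun x => exists y, y <> hs_zero X /\ y = hs_scal X lam (J'' x y).

End Defs.

(* Main.v *)
(** Write [B x = I - lam J''(x)], the Hessian of the energy [x |-> |x|^2 / 2 - lam J x]; the set
    [A] of the theorem is the set of points where [B x] is singular. Since [J'] is compact and [J'']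
    symmetric, a positive semidefinite [B x] with [x] outside [A] is coercive. Hence positive
    semidefiniteness of [B] is both open and closed along any path that avoids [A].
    Suppose that [A] is sigma-compact. In infinite dimension, countably many compact sets, and the
    cones over them, do not cover the space. So some [v] is not of the form [x - lam J' x] with [x]
    in [A], and the energy minus [<v, .>] has a global minimizer [p] (Ekeland's principle gives a
    minimizing Palais-Smale sequence, which clusters by compactness of [J'] and the growth bound);
    [p] is outside [A] and [B p] is positive semidefinite. Moreover any point [q] can be joined to
    [p] by two segments avoiding [A] except possibly at [q]. So [B q] is positive semidefinite
    for every [q], which contradicts the lower bound on [lam]. *)
Require Import Defs.
From Stdlib Require Import Reals Lra Lia List Classical ClassicalEpsilon Cantor.
Open Scope R_scope.

Local Notation "x ⊕ y" := (hs_add _ x y) (at level 50, left associativity).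
Local Notation "x ⊖ y" := (hsub _ x y) (at level 50, left associativity).
Local Notation "a ⊙ x" := (hs_scal _ a x) (at level 40, left associativity).
Local Notation "⟪ x , y ⟫" := (hs_inner _ x y).
Local Notation "⟦ x ⟧" := (hnorm _ x).

(** * Hilbert space algebra *)

Lemma inner_add_r {X : HilbertSpace} (x y z : X) : ⟪x, y ⊕ z⟫ = ⟪x, y⟫ + ⟪x, z⟫.
Proof.
  rewrite hs_inner_sym, hs_inner_add, (hs_inner_sym _ y), (hs_inner_sym _ z).
  reflexivity.
Qed.

Lemma inner_scal_r {X : HilbertSpace} a (x y : X) : ⟪x, a ⊙ y⟫ = a * ⟪x, y⟫.
Proof. rewrite hs_inner_sym, hs_inner_scal, hs_inner_sym; reflexivity. Qed.

Lemma inner_zero_l {X : HilbertSpace} (x : X) : ⟪hs_zero X, x⟫ = 0.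
Proof.
  pose proof (hs_inner_add X (hs_zero X) (hs_zero X) x) as H.
  rewrite hs_add_zero in H; lra.
Qed.

Lemma inner_zero_r {X : HilbertSpace} (x : X) : ⟪x, hs_zero X⟫ = 0.
Proof. rewrite hs_inner_sym; apply inner_zero_l. Qed.

Lemma inner_opp_l {X : HilbertSpace} (x y : X) : ⟪hs_opp X x, y⟫ = - ⟪x, y⟫.
Proof.
  pose proof (hs_inner_add X x (hs_opp X x) y) as H.
  rewrite hs_add_opp, inner_zero_l in H; lra.
Qed.

Lemma inner_opp_r {X : HilbertSpace} (x y : X) : ⟪x, hs_opp X y⟫ = - ⟪x, y⟫.
Proof. rewrite hs_inner_sym, inner_opp_l, hs_inner_sym; reflexivity. Qed.

Lemma inner_sub_l {X : HilbertSpace} (x y z : X) : ⟪x ⊖ y, z⟫ = ⟪x, z⟫ - ⟪y, z⟫.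
Proof. unfold hsub; rewrite hs_inner_add, inner_opp_l; ring. Qed.

Lemma inner_sub_r {X : HilbertSpace} (x y z : X) : ⟪x, y ⊖ z⟫ = ⟪x, y⟫ - ⟪x, z⟫.
Proof. unfold hsub; rewrite inner_add_r, inner_opp_r; ring. Qed.

Ltac inner_simpl :=
  repeat progress rewrite ?hs_inner_add, ?inner_add_r, ?hs_inner_scal, ?inner_scal_r,
    ?inner_sub_l, ?inner_sub_r, ?inner_zero_l, ?inner_zero_r, ?inner_opp_l, ?inner_opp_r.

(** Testing against an arbitrary vector turns an identity of vectors into one of real numbers, where
    [ring] applies; the tactic [vec] works this way. *)
Lemma inner_ext {X : HilbertSpace} (x y : X) : (forall w, ⟪x, w⟫ = ⟪y, w⟫) -> x = y.
Proof.
  intros H.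
  assert (E : x ⊖ y = hs_zero X).
  { apply hs_inner_def. rewrite inner_sub_l, H; ring. }
  rewrite <- (hs_add_zero X y), <- E. unfold hsub.
  rewrite (hs_add_comm _ x), hs_add_assoc, hs_add_opp, hs_add_comm, hs_add_zero.
  reflexivity.
Qed.

Ltac vec :=
  apply inner_ext; let w := fresh "w" in intro w; inner_simpl;
  try (ring || (field; auto)).

(** For [c > 0] evaluate at the vertex; for [c = 0] an affine function bounded below has slope zero.
    This yields Cauchy-Schwarz for the inner product and, later, for the form of [I - lam T]. *)
Lemma quadratic_nonneg_discr a b c : 0 <= c ->
  (forall t, 0 <= a + 2 * b * t + c * t ^ 2) -> b ^ 2 <= a * c.
Proof.
  intros Hc H. destruct Hc as [Hc|<-].
  - specialize (H (- b / c)).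
    replace (a + 2 * b * (- b / c) + c * (- b / c) ^ 2) with (a - b ^ 2 / c) in H
      by (field; lra).
    apply (Rmult_le_compat_r c) in H; [|lra].
    replace ((a - b ^ 2 / c) * c) with (a * c - b ^ 2) in H by (field; lra). lra.
  - destruct (Req_dec b 0) as [->|Hb]; [lra|].
    specialize (H ((- a - 1) / (2 * b))).
    replace (a + 2 * b * ((- a - 1) / (2 * b)) + 0 * ((- a - 1) / (2 * b)) ^ 2)
      with (-1) in H by (field; auto). lra.
Qed.

Lemma norm_nonneg {X : HilbertSpace} (x : X) : 0 <= ⟦x⟧.
Proof. apply sqrt_pos. Qed.

Lemma norm_sq {X : HilbertSpace} (x : X) : ⟦x⟧ ^ 2 = ⟪x, x⟫.
Proof. unfold hnorm. simpl. rewrite Rmult_1_r. apply sqrt_sqrt, hs_inner_pos. Qed.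

Lemma le_of_sq_le a b : 0 <= b -> a ^ 2 <= b ^ 2 -> a <= b.
Proof. intros Hb H. destruct (Rle_or_lt a b); auto. nra. Qed.

Lemma cauchy_schwarz {X : HilbertSpace} (x y : X) : Rabs ⟪x, y⟫ <= ⟦x⟧ * ⟦y⟧.
Proof.
  apply le_of_sq_le; [apply Rmult_le_pos; apply norm_nonneg|].
  rewrite pow2_abs, Rpow_mult_distr, !norm_sq.
  apply quadratic_nonneg_discr; [apply hs_inner_pos|]. intros t.
  replace (⟪x, x⟫ + 2 * ⟪x, y⟫ * t + ⟪y, y⟫ * t ^ 2) with ⟪x ⊕ t ⊙ y, x ⊕ t ⊙ y⟫.
  - apply hs_inner_pos.
  - inner_simpl. rewrite (hs_inner_sym _ y x). ring.
Qed.

Lemma inner_le {X : HilbertSpace} (x y : X) : ⟪x, y⟫ <= ⟦x⟧ * ⟦y⟧.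
Proof. eapply Rle_trans; [apply Rle_abs|apply cauchy_schwarz]. Qed.

Lemma norm_triangle {X : HilbertSpace} (x y : X) : ⟦x ⊕ y⟧ <= ⟦x⟧ + ⟦y⟧.
Proof.
  pose proof (norm_nonneg x). pose proof (norm_nonneg y).
  apply le_of_sq_le; [lra|]. pose proof (inner_le x y).
  rewrite norm_sq. inner_simpl. rewrite (hs_inner_sym _ y x), <- !norm_sq. nra.
Qed.

Lemma norm_scal {X : HilbertSpace} a (x : X) : ⟦a ⊙ x⟧ = Rabs a * ⟦x⟧.
Proof.
  unfold hnorm. inner_simpl. rewrite <- Rmult_assoc, sqrt_mult_alt by nra.
  rewrite <- sqrt_Rsqr_abs. reflexivity.
Qed.

Lemma norm_opp {X : HilbertSpace} (x : X) : ⟦hs_opp X x⟧ = ⟦x⟧.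
Proof. unfold hnorm. rewrite inner_opp_l, inner_opp_r, Ropp_involutive. reflexivity. Qed.

Lemma norm_sub_sym {X : HilbertSpace} (x y : X) : ⟦x ⊖ y⟧ = ⟦y ⊖ x⟧.
Proof. rewrite <- norm_opp. f_equal. vec. Qed.

Lemma norm_sub_le {X : HilbertSpace} (x y : X) : ⟦x ⊖ y⟧ <= ⟦x⟧ + ⟦y⟧.
Proof. rewrite <- (norm_opp y). apply norm_triangle. Qed.

Lemma norm_zero {X : HilbertSpace} : ⟦hs_zero X⟧ = 0.
Proof. unfold hnorm. rewrite inner_zero_l. apply sqrt_0. Qed.

Lemma norm_sub_diag {X : HilbertSpace} (x : X) : ⟦x ⊖ x⟧ = 0.
Proof. rewrite <- (@norm_zero X). f_equal. vec. Qed.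

Lemma norm_eq_zero {X : HilbertSpace} (x : X) : ⟦x⟧ = 0 -> x = hs_zero X.
Proof. intros H. apply hs_inner_def. rewrite <- norm_sq, H. ring. Qed.

Lemma norm_pos {X : HilbertSpace} (x : X) : x <> hs_zero X -> 0 < ⟦x⟧.
Proof.
  intros H. destruct (norm_nonneg x) as [|E]; auto. destruct H.
  apply norm_eq_zero. auto.
Qed.

Lemma dist_triangle {X : HilbertSpace} (x y z : X) : ⟦x ⊖ z⟧ <= ⟦x ⊖ y⟧ + ⟦y ⊖ z⟧.
Proof.
  replace (x ⊖ z) with ((x ⊖ y) ⊕ (y ⊖ z)) by vec. apply norm_triangle.
Qed.

Lemma norm_le_dist {X : HilbertSpace} (x y : X) : ⟦x⟧ <= ⟦y⟧ + ⟦x ⊖ y⟧.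
Proof.
  replace x with (y ⊕ (x ⊖ y)) at 1 by vec. apply norm_triangle.
Qed.

Lemma norm_normalize {X : HilbertSpace} (x : X) :
  x <> hs_zero X -> ⟦/ ⟦x⟧ ⊙ x⟧ = 1.
Proof.
  intros H%norm_pos. rewrite norm_scal, Rabs_pos_eq; [field; lra|].
  apply Rlt_le, Rinv_0_lt_compat, H.
Qed.

(** * Infinite dimension and Baire category *)

Lemma lin_comb_ext {X : HilbertSpace} c c' (v v' : nat -> X) n :
  (forall i, (i < n)%nat -> c i ⊙ v i = c' i ⊙ v' i) -> lin_comb X c v n = lin_comb X c' v' n.
Proof.
  induction n as [|n IH]; intros H; simpl; auto.
  rewrite IH, H by (intros; try apply H; lia). reflexivity.
Qed.

Lemma lin_comb_add {X : HilbertSpace} a b c d (v : nat -> X) n :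
  lin_comb X (fun i => a * c i + b * d i) v n
  = a ⊙ lin_comb X c v n ⊕ b ⊙ lin_comb X d v n.
Proof.
  induction n as [|n IH]; simpl; [vec|]. rewrite IH. vec.
Qed.

Lemma lin_comb_upd {X : HilbertSpace} c (v : nat -> X) n j (w : X) : (j < n)%nat ->
  lin_comb X c (fun i => if Nat.eq_dec i j then w else v i) n
  = lin_comb X (fun i => if Nat.eq_dec i j then 0 else c i) v n ⊕ c j ⊙ w.
Proof.
  induction n as [|n IH]; intros H; [lia|]. simpl.
  destruct (Nat.eq_dec n j) as [->|Hn].
  - rewrite (lin_comb_ext c (fun i => if Nat.eq_dec i j then 0 else c i)
               (fun i => if Nat.eq_dec i j then w else v i) v).
    + vec.
    + intros i Hi. destruct (Nat.eq_dec i j); [lia|reflexivity].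
  - rewrite IH by lia. vec.
Qed.

(** A homogeneous linear system with one more unknown than equations has a nonzero solution. The
    family [v] is quantified inside the induction, since the step also uses the hypothesis for a
    modified family. *)
Lemma orthogonal_combination {X : HilbertSpace} (l : list X) : forall v : nat -> X,
  exists c, (exists j, (j <= length l)%nat /\ c j <> 0) /\
    forall w, In w l -> ⟪lin_comb X c v (S (length l)), w⟫ = 0.
Proof.
  induction l as [|w l IH]; intros v.
  - exists (fun _ => 1). split; [exists 0%nat; split; [auto|lra]|intros w []].
  - set (k := length l) in *. simpl length. fold k.
    (* The first [k + 1] vectors give a combination orthogonal to [l]; trading one that occurs in
       it for [v (S k)] gives a second one, and a combination of the two kills [w]. *)
    destruct (IH v) as (c & (j & Hj & Hcj) & Hc).
    destruct (IH (fun i => if Nat.eq_dec i j then v (S k) else v i))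
      as (d & (i & Hi & Hdi) & Hd).
    set (u := lin_comb X c v (S k)) in *.
    set (u' := lin_comb X d _ (S k)) in *.
    set (c0 := fun i => if Nat.eq_dec i (S k) then 0 else c i).
    (* [d] combines the family in which [v (S k)] stands at place [j]; moving that coefficient to
       place [S k] expresses the same vector over [v]. *)
    set (d0 := fun i => if Nat.eq_dec i (S k) then d j
                        else if Nat.eq_dec i j then 0 else d i).
    assert (Eu : lin_comb X c0 v (S (S k)) = u).
    { change (lin_comb X c0 v (S k) ⊕ c0 (S k) ⊙ v (S k) = u). unfold u.
      rewrite (lin_comb_ext c0 c v v).
      - unfold c0. destruct (Nat.eq_dec (S k) (S k)); [vec|lia].
      - intros m Hm. unfold c0. destruct (Nat.eq_dec m (S k)); [lia|auto]. }
    assert (Eu' : lin_comb X d0 v (S (S k)) = u').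
    { change (lin_comb X d0 v (S k) ⊕ d0 (S k) ⊙ v (S k) = u'). unfold u'.
      rewrite lin_comb_upd by (auto; lia). f_equal.
      - apply lin_comb_ext. intros m Hm. unfold d0.
        destruct (Nat.eq_dec m (S k)); [lia|auto].
      - unfold d0. destruct (Nat.eq_dec (S k) (S k)); [auto|lia]. }
    destruct (Req_dec ⟪u', w⟫ 0) as [E|E].
    + exists d0. rewrite Eu'. split.
      * destruct (Nat.eq_dec i j) as [->|Hij].
        -- exists (S k). split; [lia|]. unfold d0.
           destruct (Nat.eq_dec (S k) (S k)); [auto|lia].
        -- exists i. split; [lia|]. unfold d0.
           destruct (Nat.eq_dec i (S k)); [lia|]. destruct (Nat.eq_dec i j); [lia|auto].
      * intros w' [<-|Hw]; auto.
    + exists (fun m => ⟪u', w⟫ * c0 m + - ⟪u, w⟫ * d0 m).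
      rewrite lin_comb_add, Eu, Eu'. split.
      (* [d0] vanishes at [j], so the coefficient there is [⟪u', w⟫ * c j], a product of nonzero
         numbers. *)
      * exists j. split; [lia|]. unfold c0, d0.
        destruct (Nat.eq_dec j (S k)); [lia|]. destruct (Nat.eq_dec j j); [|lia].
        rewrite Rmult_0_r, Rplus_0_r. apply Rmult_integral_contrapositive; auto.
      * intros w' [<-|Hw]; inner_simpl; [ring|].
        rewrite (Hc w'), (Hd w') by auto. ring.
Qed.

Lemma orthogonal_unit {X : HilbertSpace} : infinite_dim X ->
  forall l : list X, exists u : X, ⟦u⟧ = 1 /\ forall w, In w l -> ⟪u, w⟫ = 0.
Proof.
  intros HX l. destruct (HX (S (length l))) as [v Hv].
  destruct (orthogonal_combination l v) as (c & (j & Hj & Hcj) & Hc).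
  set (u := lin_comb X c v (S (length l))) in *.
  assert (Hu : u <> hs_zero X).
  { intros E. apply Hcj. apply (Hv c E). lia. }
  exists (/ ⟦u⟧ ⊙ u). split; [apply norm_normalize, Hu|].
  intros w Hw. inner_simpl. rewrite Hc by auto. ring.
Qed.

Definition converges {X : HilbertSpace} (u : nat -> X) (z : X) : Prop :=
  forall e, 0 < e -> exists N, forall n, (N <= n)%nat -> ⟦u n ⊖ z⟧ < e.

Lemma telescoping_dist {X : HilbertSpace} (u : nat -> X) (a : nat -> R) :
  (forall n, ⟦u (S n) ⊖ u n⟧ <= a n - a (S n)) ->
  forall n m, (n <= m)%nat -> ⟦u m ⊖ u n⟧ <= a n - a m.
Proof.
  intros H n m Hnm. induction Hnm as [|m Hnm IH].
  - rewrite norm_sub_diag. lra.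
  - pose proof (dist_triangle (u (S m)) (u m) (u n)). specialize (H m). lra.
Qed.

(** The sequence [a] is nonincreasing and bounded below, hence Cauchy, and its decrements dominate
    the steps of [u]. This drives the Baire argument, the extraction of cluster points and Ekeland's
    principle. *)
Lemma telescoping_converges {X : HilbertSpace} (u : nat -> X) (a : nat -> R) :
  (forall n, 0 <= a n) -> (forall n, ⟦u (S n) ⊖ u n⟧ <= a n - a (S n)) ->
  exists z, converges u z /\ forall n, ⟦z ⊖ u n⟧ <= a n.
Proof.
  intros Ha H. pose proof (telescoping_dist u a H) as Hd.
  assert (Hc : Cauchy_crit a).
  { apply CV_Cauchy, decreasing_cv.
    - intros n. specialize (H n). pose proof (norm_nonneg (u (S n) ⊖ u n)). lra.
    - exists 0. intros x [n ->]. unfold opp_seq. specialize (Ha n). lra. }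
  destruct (hs_complete X u) as [z Hz].
  { intros e He. destruct (Hc e He) as [N HN]. exists N. intros m n Hm Hn.
    change (⟦u m ⊖ u n⟧ < e). specialize (HN m n Hm Hn). unfold Rdist in HN.
    apply Rabs_def2 in HN.
    destruct (Nat.le_ge_cases m n) as [L|L].
    - rewrite norm_sub_sym. specialize (Hd m n L). lra.
    - specialize (Hd n m L). lra. }
  exists z. split; [exact Hz|]. intros n. apply Rle_plus_epsilon. intros e He.
  destruct (Hz e He) as [N HN]. specialize (HN (max n N) (Nat.le_max_r _ _)).
  change (⟦u (max n N) ⊖ z⟧ < e) in HN.
  specialize (Hd n (max n N) (Nat.le_max_l _ _)). specialize (Ha (max n N)).
  pose proof (dist_triangle z (u (max n N)) (u n)). rewrite norm_sub_sym in HN. lra.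
Qed.

(* Approximable, to any precision, by a finite-dimensional subspace: being orthogonal to the
   orthogonal complement of [l] replaces membership in the span of [l]. *)
Definition thin {X : HilbertSpace} (S : X -> Prop) : Prop :=
  forall e, 0 < e -> exists l : list X, forall s, S s ->
    exists w, (forall u, (forall c, In c l -> ⟪u, c⟫ = 0) -> ⟪u, w⟫ = 0) /\ ⟦s ⊖ w⟧ < e.

(** Move by [r] in a unit direction [u] orthogonal to [x] and to [l]. The component along [u] is [r]
    at the new point and zero at each approximant [w], so [w] is at least [r] away and [s] at least
    [r / 2]. *)
Lemma thin_avoid {X : HilbertSpace} (S : X -> Prop) : infinite_dim X -> thin S ->
  forall x r, 0 < r ->
  exists y, ⟦y ⊖ x⟧ <= r /\ forall s, S s -> r / 2 <= ⟦s ⊖ y⟧.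
Proof.
  intros HX HS x r Hr. destruct (HS (r / 2)) as [l Hl]; [lra|].
  destruct (orthogonal_unit HX (x :: l)) as (u & Hu & Ho).
  exists (x ⊕ r ⊙ u). split.
  - replace (x ⊕ r ⊙ u ⊖ x) with (r ⊙ u) by vec.
    rewrite norm_scal, Hu, Rabs_pos_eq; lra.
  - intros s Hs. destruct (Hl s Hs) as (w & Hw & Hsw).
    pose proof (inner_le u (x ⊕ r ⊙ u ⊖ w)) as H. revert H.
    rewrite Hu. inner_simpl. rewrite <- norm_sq, Hu, Ho, Hw; [|intros; apply Ho; right; auto|left; auto].
    intros H. pose proof (dist_triangle (x ⊕ r ⊙ u) s w).
    rewrite (norm_sub_sym s (x ⊕ r ⊙ u)). lra.
Qed.

(** A quantitative Baire argument: move number [n] ends at distance at least [r n / 2] from [S n],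
    and all later moves together amount to at most [4 / 3 * r (n + 1) = r n / 3], so the limit stays
    off every [S n]. *)
Lemma thin_union_not_full {X : HilbertSpace} (S : nat -> X -> Prop) :
  infinite_dim X -> (forall n, thin (S n)) -> exists z, forall n, ~ S n z.
Proof.
  intros HX HS. set (r := fun n => (/ 4) ^ n).
  assert (Hr : forall n, 0 < r n) by (intros; apply pow_lt; lra).
  assert (HrS : forall n, r (Datatypes.S n) = r n / 4) by (intros; unfold r; simpl; lra).
  destruct (choice (fun (p : nat * X) y => ⟦y ⊖ snd p⟧ <= r (fst p) /\
      forall s, S (fst p) s -> r (fst p) / 2 <= ⟦s ⊖ y⟧)) as [f Hf].
  { intros [n x]. apply thin_avoid; simpl; auto. }
  set (u := nat_rect (fun _ => X) (hs_zero X) (fun n x => f (n, x))).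
  destruct (telescoping_converges u (fun n => 4 / 3 * r n)) as (z & _ & Hz).
  - intros n. specialize (Hr n). lra.
  - intros n. destruct (Hf (n, u n)) as [H _]. simpl in *. rewrite HrS. lra.
  - exists z. intros n Hs. destruct (Hf (n, u n)) as [_ H].
    specialize (H z Hs). specialize (Hz (Datatypes.S n)). simpl in *.
    rewrite HrS in Hz. specialize (Hr n). lra.
Qed.

(** * Total boundedness *)

Definition totally_bounded {X : HilbertSpace} (S : X -> Prop) : Prop :=
  forall e, 0 < e -> exists l : list X, forall x, S x -> exists c, In c l /\ ⟦x ⊖ c⟧ < e.

Lemma compact_image_totally_bounded {X : HilbertSpace} (K : X -> Prop) (f : X -> X) :
  is_compact X K -> continuous_map X f -> totally_bounded (image X f K).
Proof.
  intros HK Hf e He.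
  destruct (HK X (fun c x => ⟦f x ⊖ c⟧ < e)) as [l Hl].
  - intros c x Hx. destruct (Hf x (e - ⟦f x ⊖ c⟧)) as (d & Hd & H); [lra|].
    exists d. split; [exact Hd|]. intros y Hy. specialize (H y Hy).
    pose proof (dist_triangle (f y) (f x) c). lra.
  - intros x _. exists (f x). rewrite norm_sub_diag. exact He.
  - exists l. intros y (x & Hx & <-). apply Hl, Hx.
Qed.

Lemma compact_totally_bounded {X : HilbertSpace} (K : X -> Prop) :
  is_compact X K -> totally_bounded K.
Proof.
  intros HK e He. destruct (compact_image_totally_bounded K (fun x => x) HK) with (e := e)
    as [l Hl]; auto.
  - intros x eps Heps. exists eps. auto.
  - exists l. intros x Hx. apply Hl. exists x. auto.
Qed.

Lemma rel_compact_totally_bounded {X : HilbertSpace} (S : X -> Prop) :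
  rel_compact X S -> totally_bounded S.
Proof.
  intros H e He. destruct (compact_totally_bounded _ H e He) as [l Hl].
  exists l. intros x Hx. apply Hl. intros e' He'. exists x.
  rewrite norm_sub_diag. auto.
Qed.

Lemma totally_bounded_bounded {X : HilbertSpace} (S : X -> Prop) :
  totally_bounded S -> exists C, forall x, S x -> ⟦x⟧ <= C.
Proof.
  intros H. destruct (H 1) as [l Hl]; [lra|].
  assert (Hb : exists C, forall c, In c l -> ⟦c⟧ <= C).
  { clear. induction l as [|c l [C IH]]; [exists 0; intros c []|].
    exists (Rmax ⟦c⟧ C). intros x [<-|Hx]; [apply Rmax_l|].
    eapply Rle_trans; [apply IH, Hx|apply Rmax_r]. }
  destruct Hb as [C HC]. exists (C + 1). intros x Hx.
  destruct (Hl x Hx) as (c & Hc & Hxc). specialize (HC c Hc).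
  pose proof (norm_le_dist x c). lra.
Qed.

Lemma totally_bounded_thin {X : HilbertSpace} (S : X -> Prop) : totally_bounded S -> thin S.
Proof.
  intros H e He. destruct (H e He) as [l Hl]. exists l. intros s Hs.
  destruct (Hl s Hs) as (c & Hc & Hsc). exists c. auto.
Qed.

(** Adding [q] to the list makes the vertex orthogonal to every test vector, and the error in
    approximating [s] grows by a factor of at most [m]. The tolerance [e / (m + 1)] absorbs this and
    stays defined at [m = 0]. *)
Lemma thin_cone {X : HilbertSpace} (S : X -> Prop) (q : X) (m : R) : thin S ->
  thin (fun x => exists s t, S s /\ Rabs t <= m /\ x = q ⊕ t ⊙ (s ⊖ q)).
Proof.
  intros H e He. destruct (Rlt_or_le m 0) as [Hm|Hm].
  { exists nil. intros x (s & t & _ & Ht & _). pose proof (Rabs_pos t). lra. }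
  destruct (H (e / (m + 1))) as [l Hl]; [apply Rdiv_lt_0_compat; lra|].
  exists (q :: l). intros x (s & t & Hs & Ht & ->).
  destruct (Hl s Hs) as (w & Hw & Hsw).
  exists (q ⊕ t ⊙ (w ⊖ q)). split.
  - intros u Hu. inner_simpl. rewrite Hw, Hu; [ring|left; auto|].
    intros c Hc. apply Hu. right. auto.
  - replace (q ⊕ t ⊙ (s ⊖ q) ⊖ (q ⊕ t ⊙ (w ⊖ q))) with (t ⊙ (s ⊖ w)) by vec.
    rewrite norm_scal.
    apply Rle_lt_trans with (m * ⟦s ⊖ w⟧).
    { apply Rmult_le_compat_r; auto using norm_nonneg. }
    apply Rle_lt_trans with (m * (e / (m + 1))).
    { apply Rmult_le_compat_l; lra. }
    replace (m * (e / (m + 1))) with (e - e / (m + 1)) by (field; lra).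
    pose proof (Rdiv_lt_0_compat e (m + 1)). lra.
Qed.

Lemma thin_union {X : HilbertSpace} (S S' : X -> Prop) :
  thin S -> thin S' -> thin (fun x => S x \/ S' x).
Proof.
  intros H H' e He. destruct (H e He) as [l Hl]. destruct (H' e He) as [l' Hl'].
  exists (l ++ l'). intros s [Hs|Hs].
  - destruct (Hl s Hs) as (w & Hw & Hsw). exists w. split; [|exact Hsw].
    intros u Hu. apply Hw. intros c Hc. apply Hu, in_or_app. auto.
  - destruct (Hl' s Hs) as (w & Hw & Hsw). exists w. split; [|exact Hsw].
    intros u Hu. apply Hw. intros c Hc. apply Hu, in_or_app. auto.
Qed.

(** If the point at parameter [t] of the segment from [a] to [z] is some [s] in [K n], then
    [z = a + (1 / t) (s - a)] lies in the cone over [K n] with vertex [a]. Bounding [1 / t] by an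
    integer leaves countably many thin cones, indexed by pairs through the Cantor bijection. *)
Lemma segments_avoid {X : HilbertSpace} (K : nat -> X -> Prop) (p q : X) :
  infinite_dim X -> (forall n, thin (K n)) ->
  exists z, forall a, a = p \/ a = q -> forall t, 0 < t <= 1 ->
    forall n, ~ K n (a ⊕ t ⊙ (z ⊖ a)).
Proof.
  intros HX HK.
  set (cone := fun (a : X) i x => exists s t, K (fst (Cantor.of_nat i)) s /\
    Rabs t <= INR (snd (Cantor.of_nat i)) /\ x = a ⊕ t ⊙ (s ⊖ a)).
  destruct (thin_union_not_full (fun i x => cone p i x \/ cone q i x) HX) as [z Hz].
  { intros i. apply thin_union; apply thin_cone, HK. }
  exists z. intros a Ha t Ht n Hn. destruct (INR_unbounded (/ t)) as [k Hk].
  assert (Hc : cone a (Cantor.to_nat (n, k)) z).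
  { exists (a ⊕ t ⊙ (z ⊖ a)), (/ t). rewrite Cantor.cancel_of_to. cbn [fst snd].
    split; [exact Hn|]. split; [|vec; lra].
    rewrite Rabs_pos_eq; [lra|]. apply Rlt_le, Rinv_0_lt_compat. lra. }
  apply (Hz (Cantor.to_nat (n, k))). destruct Ha as [<-|<-]; auto.
Qed.

(** * Cluster points of sequences *)

Definition frequently (P : nat -> Prop) : Prop := forall N, exists n, (N <= n)%nat /\ P n.

Lemma frequently_pigeonhole {A : Type} (l : list A) (P : nat -> Prop) (Q : A -> nat -> Prop) :
  frequently P ->
  (exists N, forall n, (N <= n)%nat -> P n -> exists c, In c l /\ Q c n) ->
  exists c, frequently (fun n => P n /\ Q c n).
Proof.
  revert P. induction l as [|c l IH]; intros P HP [N HN].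
  - destruct (HP N) as (n & Hn & Pn). destruct (HN n Hn Pn) as (c & [] & _).
  - destruct (classic (frequently (fun n => P n /\ Q c n))) as [|Hc]; [exists c; auto|].
    apply not_all_ex_not in Hc. destruct Hc as [N' HN'].
    destruct (IH P HP) as [c' Hc']; [|exists c'; auto].
    exists (max N N'). intros n Hn Pn.
    destruct (HN n) as (c0 & [<-|Hc0] & Hq); auto; [lia| |exists c0; auto].
    exfalso. apply HN'. exists n. split; [lia|auto].
Qed.

(** Balls of radius [r k] are chosen one after another, each visited infinitely often by the terms
    that satisfy all earlier constraints. Only tails of [u] have to be covered, which suits
    sequences that approach a totally bounded set without lying in it. *)
Lemma cluster_point {X : HilbertSpace} (u : nat -> X) :
  (forall e, 0 < e -> exists (N : nat) (l : list X), forall n, (N <= n)%nat ->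
     exists c, In c l /\ ⟦u n ⊖ c⟧ < e) ->
  exists z, forall e, 0 < e -> frequently (fun n => ⟦u n ⊖ z⟧ < e).
Proof.
  intros H. set (r := fun k => (/ 2) ^ k).
  assert (Hr : forall k, 0 < r k) by (intros; apply pow_lt; lra).
  assert (HrS : forall k, r (S k) = r k / 2) by (intros; unfold r; simpl; lra).
  destruct (choice (fun (p : nat * (nat -> Prop)) c => frequently (snd p) ->
      frequently (fun n => snd p n /\ ⟦u n ⊖ c⟧ < r (fst p)))) as [f Hf].
  (* The value [u 0] is a dummy for predicates that are not frequent. *)
  { intros [k P]. destruct (classic (frequently P)) as [HP|HP]; [|exists (u 0%nat); tauto].
    destruct (H (r k) (Hr k)) as (N & l & Hl).
    destruct (frequently_pigeonhole l P (fun c n => ⟦u n ⊖ c⟧ < r k) HP) as [c Hc];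
      [|exists c; auto].
    exists N. auto. }
  set (P := nat_rect (fun _ => nat -> Prop) (fun _ => True)
              (fun k Q n => Q n /\ ⟦u n ⊖ f (k, Q)⟧ < r k)).
  assert (HP : forall k, frequently (P k)).
  { induction k as [|k IH]; [intros N; exists N; simpl; auto|].
    apply (Hf (k, P k) IH). }
  set (c := fun k => f (k, P k)).
  (* Consecutive centres have a term of [u] near both, so they are less than [r k + r (S k)] apart,
     which equals [3 * r k - 3 * r (S k)]. *)
  destruct (telescoping_converges c (fun k => 3 * r k)) as (z & _ & Hz).
  - intros k. specialize (Hr k). lra.
  - intros k. destruct (HP (S (S k)) 0%nat) as (n & _ & [[_ H1] H2]).
    fold (P k) in H1. fold (P (S k)) in H2. fold (c k) in H1. fold (c (S k)) in H2.
    pose proof (dist_triangle (c (S k)) (u n) (c k)).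
    rewrite norm_sub_sym in H2. specialize (HrS k). lra.
  - exists z. intros e He N.
    destruct (pow_lt_1_zero (/ 2)) with (y := e / 4) as [k Hk].
    { rewrite Rabs_pos_eq; lra. } { lra. }
    specialize (Hk k (le_n k)). fold (r k) in Hk.
    rewrite Rabs_pos_eq in Hk by (apply Rlt_le, Hr).
    destruct (HP (S k) N) as (n & Hn & [_ H1]). exists n. split; [exact Hn|].
    fold (P k) in H1. fold (c k) in H1. specialize (Hz k).
    pose proof (dist_triangle (u n) (c k) z). rewrite (norm_sub_sym z) in Hz. lra.
Qed.

(** * Approximate minimizers *)

Lemma near_minimizer {A : Type} (P : A -> Prop) (g : A -> R) (m : R) :
  (exists a, P a) -> (forall a, P a -> m <= g a) ->
  forall e, 0 < e -> exists a, P a /\ forall b, P b -> g a <= g b + e.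
Proof.
  intros [a0 Ha0] Hm e He.
  destruct (completeness (fun y => exists a, P a /\ y = - g a)) as [s [Hub Hlub]].
  - exists (- m). intros y (a & Ha & ->). specialize (Hm a Ha). lra.
  - exists (- g a0), a0. auto.
  - apply NNPP. intros Hn.
    assert (Hs : s <= s - e); [|lra].
    apply Hlub. intros y (a & Ha & ->). apply Rnot_lt_le. intros Hlt.
    apply Hn. exists a. split; [exact Ha|]. intros b Hb.
    assert (- g b <= s) by (apply Hub; exists b; auto). lra.
Qed.

Definition continuous_fun {X : HilbertSpace} (g : X -> R) : Prop :=
  forall x e, 0 < e -> exists d, 0 < d /\ forall z, ⟦z ⊖ x⟧ < d -> Rabs (g z - g x) < e.

(** Ekeland's principle: each [u (n + 1)] nearly minimizes [g] over [S (u n)], the points lying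
    below the downward cone of slope [e] at [u n]. The steps are controlled by the decrease of [g],
    so the sequence converges. *)
Lemma ekeland {X : HilbertSpace} (g : X -> R) (m e : R) (x0 : X) :
  continuous_fun g -> (forall x, m <= g x) -> 0 < e ->
  exists x, g x <= g x0 /\ forall z, g x <= g z + e * ⟦z ⊖ x⟧.
Proof.
  intros Hg Hm He.
  set (S := fun x z => g z + e * ⟦z ⊖ x⟧ <= g x).
  destruct (choice (fun (p : nat * X) y =>
      S (snd p) y /\ forall z, S (snd p) z -> g y <= g z + (/ 2) ^ fst p)) as [f Hf].
  { intros [n x]. apply near_minimizer with (m := m); auto.
    - exists x. unfold S. simpl. rewrite norm_sub_diag. lra.
    - apply pow_lt. lra. }
  set (u := nat_rect (fun _ => X) x0 (fun n x => f (n, x))).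
  set (a := fun n => (g (u n) - m) / e).
  assert (Ha : forall n, ⟦u (Datatypes.S n) ⊖ u n⟧ <= a n - a (Datatypes.S n)).
  { intros n. destruct (Hf (n, u n)) as [H _]. change (f (n, u n)) with (u (Datatypes.S n)) in H.
    unfold S, a in *. simpl snd in H. apply (Rmult_le_reg_l e); [exact He|].
    field_simplify; lra. }
  destruct (telescoping_converges u a) as (x & Hx & _); auto.
  { intros n. unfold a. apply Rmult_le_pos; [specialize (Hm (u n)); lra|].
    apply Rlt_le, Rinv_0_lt_compat, He. }
  assert (HS : forall n, S (u n) x).
  { intros n. apply Rle_plus_epsilon. intros eps Heps.
    destruct (Hg x (eps / 2)) as (d & Hd & Hc); [lra|].
    destruct (Hx (Rmin d (eps / 2 / e))) as [N HN].
    { apply Rmin_pos; auto. apply Rdiv_lt_0_compat; lra. }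
    specialize (HN (max n N) (Nat.le_max_r _ _)).
    pose proof (Rmin_l d (eps / 2 / e)). pose proof (Rmin_r d (eps / 2 / e)).
    pose proof (telescoping_dist u a Ha n (max n N) (Nat.le_max_l _ _)) as Hd'.
    set (v := u (max n N)) in *. set (y := u n) in *.
    assert (Hc' : Rabs (g v - g x) < eps / 2) by (apply Hc; lra). apply Rabs_def2 in Hc'.
    assert (H1 : e * ⟦v ⊖ x⟧ <= eps / 2).
    { apply Rle_trans with (e * (eps / 2 / e)); [apply Rmult_le_compat_l; lra|].
      right. field. lra. }
    assert (H2 : e * ⟦v ⊖ y⟧ <= g y - g v).
    { apply (Rmult_le_compat_l e) in Hd'; [|lra].
      replace (e * (a n - a (max n N))) with (g y - g v) in Hd'
        by (unfold a, y, v; field; lra). lra. }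
    pose proof (dist_triangle x v y). rewrite (norm_sub_sym x v) in *. nra. }
  exists x. split.
  - specialize (HS 0%nat). unfold S in HS. simpl u in HS.
    pose proof (norm_nonneg (x ⊖ x0)). nra.
  (* A point [z] violating the claim lies in every [S (u n)] by the triangle inequality;
     near-minimality of the iterates then forces [g x <= g z], a contradiction. *)
  - intros z. apply Rnot_lt_le. intros Hz.
    assert (Hxz : forall n, S (u n) z).
    { intros n. specialize (HS n). unfold S in *.
      pose proof (dist_triangle z x (u n)). nra. }
    assert (g x <= g z).
    { apply Rle_plus_epsilon. intros eps Heps.
      destruct (pow_lt_1_zero (/ 2)) with (y := eps) as [k Hk]; auto.
      { rewrite Rabs_pos_eq; lra. }
      specialize (Hk k (le_n k)). rewrite Rabs_pos_eq in Hk by (apply pow_le; lra).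
      destruct (Hf (k, u k)) as [_ H]. specialize (H z (Hxz k)).
      specialize (HS (Datatypes.S k)). unfold S in HS.
      change (f (k, u k)) with (u (Datatypes.S k)) in H. cbn [fst] in H.
      pose proof (norm_nonneg (x ⊖ u (Datatypes.S k))). nra. }
    pose proof (norm_nonneg (z ⊖ x)). nra.
Qed.

(** * Differential calculus *)

Definition has_gradient {X : HilbertSpace} (F : X -> R) (F' : X -> X) : Prop :=
  forall x e, 0 < e -> exists d, 0 < d /\ forall h, ⟦h⟧ < d ->
    Rabs (F (x ⊕ h) - F x - ⟪F' x, h⟫) <= e * ⟦h⟧.

Definition has_derivative_at {X : HilbertSpace} (G T : X -> X) (x : X) : Prop :=
  forall e, 0 < e -> exists d, 0 < d /\ forall h, ⟦h⟧ < d ->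
    ⟦G (x ⊕ h) ⊖ G x ⊖ T h⟧ <= e * ⟦h⟧.

Lemma has_gradient_line {X : HilbertSpace} (F : X -> R) F' (x h : X) t :
  has_gradient F F' -> derivable_pt_lim (fun t => F (x ⊕ t ⊙ h)) t ⟪F' (x ⊕ t ⊙ h), h⟫.
Proof.
  intros HF e He. pose proof (norm_nonneg h) as Hh.
  destruct (HF (x ⊕ t ⊙ h) (e / (⟦h⟧ + 1))) as (d & Hd & H);
    [apply Rdiv_lt_0_compat; lra|].
  assert (Hd' : 0 < d / (⟦h⟧ + 1)) by (apply Rdiv_lt_0_compat; lra).
  exists (mkposreal _ Hd'). intros s Hs0 Hs. cbn [pos] in Hs.
  assert (Hs' : Rabs s * (⟦h⟧ + 1) < d).
  { apply (Rmult_lt_compat_r (⟦h⟧ + 1)) in Hs; [|lra].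
    replace (d / (⟦h⟧ + 1) * (⟦h⟧ + 1)) with d in Hs by (field; lra). exact Hs. }
  pose proof (Rabs_pos_lt s Hs0) as Hsp.
  specialize (H (s ⊙ h)). rewrite norm_scal, inner_scal_r in H.
  replace (x ⊕ t ⊙ h ⊕ s ⊙ h) with (x ⊕ (t + s) ⊙ h) in H by vec.
  specialize (H ltac:(nra)).
  set (D := F (x ⊕ (t + s) ⊙ h) - F (x ⊕ t ⊙ h)) in *. set (l := ⟪F' _, h⟫) in *.
  replace (D / s - l) with ((D - s * l) / s) by (field; auto).
  unfold Rdiv at 1. rewrite Rabs_mult, Rabs_inv.
  apply (Rmult_lt_reg_r (Rabs s)); [exact Hsp|].
  rewrite Rmult_assoc, Rinv_l, Rmult_1_r by lra.
  eapply Rle_lt_trans; [exact H|].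
  replace (e / (⟦h⟧ + 1) * (Rabs s * ⟦h⟧))
    with (e * Rabs s - e / (⟦h⟧ + 1) * Rabs s) by (field; lra).
  assert (0 < e / (⟦h⟧ + 1) * Rabs s); [|lra].
  apply Rmult_lt_0_compat; auto. apply Rdiv_lt_0_compat; lra.
Qed.

Lemma has_gradient_mean_value {X : HilbertSpace} (F : X -> R) F' (x h : X) :
  has_gradient F F' -> exists t, 0 < t < 1 /\ F (x ⊕ h) - F x = ⟪F' (x ⊕ t ⊙ h), h⟫.
Proof.
  intros HF.
  destruct (MVT_cor2 (fun t => F (x ⊕ t ⊙ h)) (fun t => ⟪F' (x ⊕ t ⊙ h), h⟫) 0 1)
    as (t & E & Ht); [lra| |].
  { intros c _. apply has_gradient_line, HF. }
  exists t. split; [exact Ht|].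
  replace (x ⊕ 1 ⊙ h) with (x ⊕ h) in E by vec.
  replace (x ⊕ 0 ⊙ h) with x in E by vec. lra.
Qed.

Lemma has_gradient_continuous {X : HilbertSpace} (F : X -> R) F' :
  has_gradient F F' -> continuous_fun F.
Proof.
  intros HF x e He. destruct (HF x 1) as (d & Hd & H); [lra|].
  pose proof (norm_nonneg (F' x)) as Hn.
  exists (Rmin d (e / (⟦F' x⟧ + 1))). split.
  { apply Rmin_pos; auto. apply Rdiv_lt_0_compat; lra. }
  intros z Hz. pose proof (Rmin_l d (e / (⟦F' x⟧ + 1))).
  pose proof (Rmin_r d (e / (⟦F' x⟧ + 1))).
  specialize (H (z ⊖ x) ltac:(lra)).
  replace (x ⊕ (z ⊖ x)) with z in H by vec.
  pose proof (cauchy_schwarz (F' x) (z ⊖ x)).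
  assert (⟦z ⊖ x⟧ * (⟦F' x⟧ + 1) < e).
  { apply Rlt_le_trans with (e / (⟦F' x⟧ + 1) * (⟦F' x⟧ + 1)).
    - apply Rmult_lt_compat_r; lra.
    - right. field. lra. }
  replace (F z - F x) with ((F z - F x - ⟪F' x, z ⊖ x⟫) + ⟪F' x, z ⊖ x⟫) by ring.
  eapply Rle_lt_trans; [apply Rabs_triang|]. lra.
Qed.

(** The mean value theorem applied to [F (z ⊕ b) - F z] as a function of [z]. *)
Lemma second_difference {X : HilbertSpace} (F : X -> R) F' (x a b : X) :
  has_gradient F F' -> exists t, 0 < t < 1 /\
    F (x ⊕ a ⊕ b) - F (x ⊕ a) - (F (x ⊕ b) - F x)
    = ⟪F' (x ⊕ (t ⊙ a ⊕ b)) ⊖ F' (x ⊕ t ⊙ a), a⟫.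
Proof.
  intros HF.
  destruct (has_gradient_mean_value (fun z => F (z ⊕ b) - F z)
              (fun z => F' (z ⊕ b) ⊖ F' z) x a) as (t & Ht & E).
  - intros z e He.
    destruct (HF (z ⊕ b) (e / 2)) as (d1 & Hd1 & K1); [lra|].
    destruct (HF z (e / 2)) as (d2 & Hd2 & K2); [lra|].
    exists (Rmin d1 d2). split; [apply Rmin_pos; auto|]. intros h Hh.
    pose proof (Rmin_l d1 d2). pose proof (Rmin_r d1 d2).
    specialize (K1 h ltac:(lra)). specialize (K2 h ltac:(lra)).
    rewrite inner_sub_l.
    replace (z ⊕ h ⊕ b) with (z ⊕ b ⊕ h) by vec.
    set (A := F (z ⊕ b ⊕ h) - F (z ⊕ b) - ⟪F' (z ⊕ b), h⟫) in *.
    set (B := F (z ⊕ h) - F z - ⟪F' z, h⟫) in *.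
    replace (_ - _) with (A - B) by (unfold A, B; ring).
    unfold Rminus. eapply Rle_trans; [apply Rabs_triang|]. rewrite Rabs_Ropp. lra.
  - exists t. split; [exact Ht|]. rewrite E.
    replace (x ⊕ t ⊙ a ⊕ b) with (x ⊕ (t ⊙ a ⊕ b)) by vec. reflexivity.
Qed.

(** The second difference of [F] with sides [s ⊙ h] and [s ⊙ k] does not depend on their order. It
    equals [s ^ 2 * ⟪T k, h⟫] or [s ^ 2 * ⟪T h, k⟫], according to the side used in the mean value
    theorem, up to [s ^ 2] times an arbitrarily small error. *)
Lemma hessian_symmetric {X : HilbertSpace} (F : X -> R) F' T (x : X) :
  has_gradient F F' -> bounded_linear X T -> has_derivative_at F' T x ->
  forall h k, ⟪T h, k⟫ = ⟪T k, h⟫.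
Proof.
  intros HF (Tadd & Tscal & _) HT.
  assert (Hbound : forall h k e, 0 < e ->
    ⟪T k, h⟫ - ⟪T h, k⟫ <= e * (4 * (⟦h⟧ + ⟦k⟧ + 1) ^ 2)).
  { intros h k e He. destruct (HT e He) as (d & Hd & H).
    set (N := ⟦h⟧ + ⟦k⟧ + 1). pose proof (norm_nonneg h). pose proof (norm_nonneg k).
    (* This scale keeps both increments [h1] and [h2] below shorter than [d]. *)
    set (s := d / (2 * N)).
    assert (HN : 0 < N) by (unfold N; lra).
    assert (Hs : 0 < s) by (apply Rdiv_lt_0_compat; lra).
    assert (Hsd : s * N < d) by (unfold s; replace (d / (2 * N) * N) with (d / 2) by (field; lra); lra).
    assert (Q : forall a b, ⟦a⟧ + ⟦b⟧ <= N -> exists D,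
       D = F (x ⊕ s ⊙ a ⊕ s ⊙ b) - F (x ⊕ s ⊙ a) - (F (x ⊕ s ⊙ b) - F x) /\
       Rabs (D - s ^ 2 * ⟪T b, a⟫) <= s ^ 2 * (e * (2 * N ^ 2))).
    { intros a b Hab. pose proof (norm_nonneg a). pose proof (norm_nonneg b).
      destruct (second_difference F F' x (s ⊙ a) (s ⊙ b) HF) as (t & Ht & E).
      eexists. split; [reflexivity|]. rewrite E.
      set (h1 := t ⊙ (s ⊙ a) ⊕ s ⊙ b). set (h2 := t ⊙ (s ⊙ a)).
      assert (B2 : ⟦h2⟧ <= s * N).
      { unfold h2. rewrite !norm_scal, !Rabs_pos_eq by lra.
        apply Rle_trans with (1 * (s * ⟦a⟧)); [apply Rmult_le_compat_r; nra|nra]. }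
      assert (B1 : ⟦h1⟧ <= s * N).
      { unfold h1. eapply Rle_trans; [apply norm_triangle|].
        rewrite !norm_scal, !Rabs_pos_eq by lra.
        apply Rle_trans with (1 * (s * ⟦a⟧) + s * ⟦b⟧); [|nra].
        apply Rplus_le_compat_r, Rmult_le_compat_r; nra. }
      pose proof (H h1 ltac:(lra)) as K1. pose proof (H h2 ltac:(lra)) as K2.
      assert (E1 : T h1 ⊖ T h2 = s ⊙ T b).
      { unfold h1, h2. rewrite !Tadd, !Tscal. vec. }
      replace (⟪F' (x ⊕ h1) ⊖ F' (x ⊕ h2), s ⊙ a⟫ - s ^ 2 * ⟪T b, a⟫)
        with ⟪(F' (x ⊕ h1) ⊖ F' x ⊖ T h1) ⊖ (F' (x ⊕ h2) ⊖ F' x ⊖ T h2), s ⊙ a⟫.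
      2: { replace (s ^ 2 * ⟪T b, a⟫) with ⟪s ⊙ T b, s ⊙ a⟫ by (inner_simpl; ring).
           rewrite <- E1. inner_simpl. ring. }
      eapply Rle_trans; [apply cauchy_schwarz|].
      set (u := F' (x ⊕ h1) ⊖ F' x ⊖ T h1) in *. set (v := F' (x ⊕ h2) ⊖ F' x ⊖ T h2) in *.
      pose proof (norm_sub_le u v). rewrite (norm_scal s a), Rabs_pos_eq by lra.
      assert (Hu : ⟦u ⊖ v⟧ <= 2 * e * (s * N)) by nra.
      apply Rle_trans with (2 * e * (s * N) * (s * N)); [|right; ring].
      apply Rmult_le_compat; [apply norm_nonneg|nra|exact Hu|nra]. }
    destruct (Q h k) as (D1 & E1 & Q1); [unfold N; lra|].
    destruct (Q k h) as (D2 & E2 & Q2); [unfold N; lra|].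
    assert (E : D1 = D2).
    { rewrite E1, E2. replace (x ⊕ s ⊙ h ⊕ s ⊙ k) with (x ⊕ s ⊙ k ⊕ s ⊙ h) by vec. ring. }
    assert (Q3 : s ^ 2 * (⟪T k, h⟫ - ⟪T h, k⟫) <= s ^ 2 * (e * (4 * N ^ 2))).
    { pose proof (Rle_abs (- (D1 - s ^ 2 * ⟪T k, h⟫))) as A1.
      pose proof (Rle_abs (D2 - s ^ 2 * ⟪T h, k⟫)) as A2. rewrite Rabs_Ropp in A1. lra. }
    apply Rmult_le_reg_l in Q3; [exact Q3|]. apply pow_lt, Hs. }
  assert (Hle : forall h k, ⟪T k, h⟫ <= ⟪T h, k⟫).
  { intros h k. apply Rle_plus_epsilon. intros e He.
    pose proof (norm_nonneg h). pose proof (norm_nonneg k).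
    set (N := 4 * (⟦h⟧ + ⟦k⟧ + 1) ^ 2).
    assert (HN : 0 < N) by (unfold N; nra).
    specialize (Hbound h k (e / N) ltac:(apply Rdiv_lt_0_compat; lra)). fold N in Hbound.
    replace (e / N * N) with e in Hbound by (field; lra). lra. }
  intros h k. apply Rle_antisym; apply Hle.
Qed.

(** Were the gradient longer than [e], a short step against it would lower [F] at a rate above [e].
    Used with [e = 0] at minimizers and with [e > 0] at points given by Ekeland's principle. *)
Lemma gradient_bound {X : HilbertSpace} (F : X -> R) F' (x : X) (e : R) :
  has_gradient F F' -> 0 <= e -> (forall z, F x <= F z + e * ⟦z ⊖ x⟧) -> ⟦F' x⟧ <= e.
Proof.
  intros HF He Hx. apply Rnot_lt_le. intros Hlt.
  set (v := F' x) in *. destruct (HF x ((⟦v⟧ - e) / 2)) as (d & Hd & H); [lra|].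
  set (t := d / (2 * ⟦v⟧)).
  assert (Ht : 0 < t) by (apply Rdiv_lt_0_compat; lra).
  assert (Hn : ⟦- t ⊙ v⟧ = t * ⟦v⟧) by (rewrite norm_scal, Rabs_Ropp, Rabs_pos_eq; lra).
  specialize (H (- t ⊙ v)). specialize (Hx (x ⊕ - t ⊙ v)).
  replace (x ⊕ - t ⊙ v ⊖ x) with (- t ⊙ v) in Hx by vec.
  rewrite Hn in *.
  assert (Hd' : t * ⟦v⟧ = d / 2) by (unfold t; field; lra).
  specialize (H ltac:(lra)). fold v in H. rewrite inner_scal_r, <- norm_sq in H.
  pose proof (Rle_abs (F (x ⊕ - t ⊙ v) - F x - - t * ⟦v⟧ ^ 2)).
  replace (- t * ⟦v⟧ ^ 2) with (- (t * ⟦v⟧) * ⟦v⟧) in * by ring. rewrite Hd' in *. nra.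
Qed.

(** The gradient vanishes at [x], so [F'] at [x ⊕ t ⊙ (s ⊙ y)] is [t * s] times [T y] up to a small
    error, while the mean value theorem makes its product with [s ⊙ y] nonnegative for some [t]. *)
Lemma second_order_condition {X : HilbertSpace} (F : X -> R) F' T (x : X) :
  has_gradient F F' -> bounded_linear X T -> has_derivative_at F' T x ->
  (forall z, F x <= F z) -> forall y, 0 <= ⟪T y, y⟫.
Proof.
  intros HF (_ & Tscal & _) HT Hx y.
  assert (H0 : F' x = hs_zero X).
  { apply norm_eq_zero, Rle_antisym; [|apply norm_nonneg].
    apply (gradient_bound F); auto; [lra|]. intros z. specialize (Hx z). lra. }
  apply Rle_plus_epsilon. intros e He. pose proof (norm_nonneg y) as Hy.
  destruct (HT (e / (⟦y⟧ + 1) ^ 2)) as (d & Hd & H).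
  { apply Rdiv_lt_0_compat; auto. apply pow_lt. lra. }
  set (s := d / (⟦y⟧ + 1)).
  assert (Hs : 0 < s) by (apply Rdiv_lt_0_compat; lra).
  destruct (has_gradient_mean_value F F' x (s ⊙ y) HF) as (t & Ht & E).
  assert (Hsy : s * ⟦y⟧ = d - s) by (unfold s; field; lra).
  specialize (H (t ⊙ (s ⊙ y))). rewrite !norm_scal, !Rabs_pos_eq in H by lra.
  specialize (H ltac:(nra)). specialize (Hx (x ⊕ s ⊙ y)).
  rewrite H0, !Tscal in H.
  set (G := F' (x ⊕ t ⊙ (s ⊙ y))) in *.
  pose proof (inner_le (G ⊖ hs_zero X ⊖ t ⊙ (s ⊙ T y)) (s ⊙ y)) as K1.
  rewrite norm_scal, Rabs_pos_eq in K1 by lra.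
  assert (K2 : 0 <= ⟪G, s ⊙ y⟫) by lra.
  assert (K3 : ⟪G, s ⊙ y⟫ = ⟪G ⊖ hs_zero X ⊖ t ⊙ (s ⊙ T y), s ⊙ y⟫ + t * s ^ 2 * ⟪T y, y⟫)
    by (inner_simpl; ring).
  assert (K4 : e / (⟦y⟧ + 1) ^ 2 * ⟦y⟧ ^ 2 <= e).
  { apply Rle_trans with (e / (⟦y⟧ + 1) ^ 2 * (⟦y⟧ + 1) ^ 2); [|right; field; lra].
    apply Rmult_le_compat_l; [|nra].
    apply Rlt_le, Rdiv_lt_0_compat; auto. apply pow_lt. lra. }
  assert (K5 : 0 <= t * s ^ 2 * (⟪T y, y⟫ + e)).
  { apply Rle_trans with (t * s ^ 2 * (⟪T y, y⟫ + e / (⟦y⟧ + 1) ^ 2 * ⟦y⟧ ^ 2)).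
    - apply (Rmult_le_compat_r (s * ⟦y⟧)) in H; [|nra].
      set (c := e / (⟦y⟧ + 1) ^ 2) in *. set (n := ⟦y⟧) in *. nra.
    - apply Rmult_le_compat_l; [|lra]. apply Rmult_le_pos; [lra|apply pow2_ge_0]. }
  assert (0 < t * s ^ 2) by (apply Rmult_lt_0_compat; [lra|apply pow_lt, Hs]).
  nra.
Qed.

(** * The operators [I - lam J''(x)] *)

Definition compact_on_balls {X : HilbertSpace} (F : X -> X) : Prop :=
  forall r, totally_bounded (image X F (fun x => ⟦x⟧ <= r)).

Lemma inv_INR_small e : 0 < e -> exists N, forall n, (N <= n)%nat -> / INR (S n) < e.
Proof.
  intros He. destruct (archimed_cor1 e He) as (N & HN & HN0). exists N.
  intros n Hn. eapply Rle_lt_trans; [|exact HN].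
  apply Rinv_le_contravar; [apply lt_0_INR; lia|apply le_INR; lia].
Qed.

Lemma inv_INR_pos n : 0 < / INR (S n).
Proof. apply Rinv_0_lt_compat, lt_0_INR. lia. Qed.

Lemma bounded_linear_bound {X : HilbertSpace} (T : X -> X) : bounded_linear X T ->
  exists C, 0 < C /\ forall y, ⟦T y⟧ <= C * ⟦y⟧.
Proof.
  intros (_ & _ & C & HC). exists (Rabs C + 1). pose proof (Rabs_pos C).
  split; [lra|]. intros y. specialize (HC y). pose proof (Rle_abs C).
  pose proof (norm_nonneg y). nra.
Qed.

(** On the unit ball [T] is uniformly close to difference quotients of [F] with the fixed step
    [d / 2], and these have a totally bounded range. *)
Lemma derivative_compact {X : HilbertSpace} (F T : X -> X) (x : X) :
  compact_on_balls F -> bounded_linear X T -> has_derivative_at F T x ->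
  totally_bounded (image X T (fun y => ⟦y⟧ <= 1)).
Proof.
  intros HF (_ & Tscal & _) HT e He.
  destruct (HT (e / 4)) as (d & Hd & H); [lra|].
  destruct (HF (⟦x⟧ + d) (e * d / 8)) as [l Hl].
  { apply Rdiv_lt_0_compat; [apply Rmult_lt_0_compat|]; lra. }
  exists (map (fun c => (2 / d) ⊙ (c ⊖ F x)) l). intros z (y & Hy & <-).
  pose proof (norm_nonneg y).
  assert (Hn : ⟦(d / 2) ⊙ y⟧ <= d / 2) by (rewrite norm_scal, Rabs_pos_eq; nra).
  specialize (H ((d / 2) ⊙ y) ltac:(lra)).
  destruct (Hl (F (x ⊕ (d / 2) ⊙ y))) as (c & Hc & Hcd).
  { eexists. split; [|reflexivity]. simpl.
    pose proof (norm_triangle x ((d / 2) ⊙ y)). lra. }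
  exists ((2 / d) ⊙ (c ⊖ F x)). split; [apply in_map_iff; eauto|].
  rewrite Tscal in H. set (G := F (x ⊕ (d / 2) ⊙ y)) in *.
  replace (T y ⊖ (2 / d) ⊙ (c ⊖ F x))
    with ((2 / d) ⊙ ((G ⊖ c) ⊖ (G ⊖ F x ⊖ (d / 2) ⊙ T y))) by (vec; lra).
  assert (H2d : 0 < 2 / d) by (apply Rdiv_lt_0_compat; lra).
  rewrite norm_scal, Rabs_pos_eq by lra.
  apply Rle_lt_trans with (2 / d * (e * d / 8 + e / 4 * (d / 2))).
  - apply Rmult_le_compat_l; [lra|]. eapply Rle_trans; [apply norm_sub_le|]. nra.
  - replace (2 / d * (e * d / 8 + e / 4 * (d / 2))) with (e / 2) by (field; lra). lra.
Qed.

(** Otherwise there are unit vectors [u n] with [u n - lam T (u n)] tending to zero. They approach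
    the totally bounded image of the ball under [lam T], hence cluster at a fixed point of [lam T];
    injectivity makes it zero, against [⟦u n⟧ = 1]. *)
Lemma injective_bounded_below {X : HilbertSpace} (T : X -> X) (lam : R) :
  bounded_linear X T -> totally_bounded (image X T (fun y => ⟦y⟧ <= 1)) ->
  (forall y, y = lam ⊙ T y -> y = hs_zero X) ->
  exists c, 0 < c /\ forall y, c * ⟦y⟧ <= ⟦y ⊖ lam ⊙ T y⟧.
Proof.
  intros HT HK Hinj. destruct (bounded_linear_bound T HT) as (C & HC & HTC).
  destruct HT as (Tadd & Tscal & _).
  apply NNPP. intros Hn.
  assert (Hu : forall n, exists y, ⟦y⟧ = 1 /\ ⟦y ⊖ lam ⊙ T y⟧ < / INR (S n)).
  { intros n. apply NNPP. intros Hy. apply Hn. exists (/ INR (S n)).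
    split; [apply inv_INR_pos|]. intros y.
    destruct (classic (y = hs_zero X)) as [->|Hy0].
    { rewrite norm_zero, Rmult_0_r. apply norm_nonneg. }
    pose proof (norm_pos y Hy0) as Hp.
    apply Rnot_lt_le. intros Hlt. apply Hy. exists (/ ⟦y⟧ ⊙ y).
    split; [apply norm_normalize, Hy0|]. rewrite Tscal.
    replace (/ ⟦y⟧ ⊙ y ⊖ lam ⊙ (/ ⟦y⟧ ⊙ T y)) with (/ ⟦y⟧ ⊙ (y ⊖ lam ⊙ T y)).
    2: { set (k := / ⟦y⟧). vec. }
    rewrite norm_scal, Rabs_pos_eq by (apply Rlt_le, Rinv_0_lt_compat, Hp).
    apply (Rmult_lt_reg_l ⟦y⟧); [exact Hp|].
    rewrite <- Rmult_assoc, Rinv_r, Rmult_1_l, Rmult_comm by lra. exact Hlt. }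
  destruct (choice _ Hu) as [u Hu'].
  assert (HL : 0 < Rabs lam + 1) by (pose proof (Rabs_pos lam); lra).
  destruct (cluster_point u) as [z Hz].
  { intros e He. destruct (inv_INR_small (e / 2)) as [N HN]; [lra|].
    destruct (HK (e / 2 / (Rabs lam + 1))) as [l Hl].
    { apply Rdiv_lt_0_compat; lra. }
    exists N, (map (fun c => lam ⊙ c) l). intros n Hn'.
    destruct (Hu' n) as [U1 U2]. destruct (Hl (T (u n))) as (c & Hc & Hcd).
    { exists (u n). split; [simpl; lra|reflexivity]. }
    exists (lam ⊙ c). split; [apply in_map_iff; eauto|].
    replace (u n ⊖ lam ⊙ c) with ((u n ⊖ lam ⊙ T (u n)) ⊕ lam ⊙ (T (u n) ⊖ c)) by vec.
    eapply Rle_lt_trans; [apply norm_triangle|]. rewrite norm_scal.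
    specialize (HN n Hn').
    assert (Rabs lam * ⟦T (u n) ⊖ c⟧ <= e / 2); [|lra].
    apply Rle_trans with ((Rabs lam + 1) * (e / 2 / (Rabs lam + 1))); [|right; field; lra].
    apply Rmult_le_compat; auto using Rabs_pos, norm_nonneg; lra. }
  assert (Hz0 : z = hs_zero X).
  { apply Hinj. apply inner_ext. intros w. apply Rminus_diag_uniq. rewrite <- inner_sub_l.
    replace (z ⊖ lam ⊙ T z) with (hs_zero X); [apply inner_zero_l|]. symmetry.
    apply norm_eq_zero, Rle_antisym; [|apply norm_nonneg].
    apply Rle_plus_epsilon. intros e He.
    set (D := 1 + (Rabs lam + 1) * C). assert (HD : 0 < D) by (unfold D; nra).
    destruct (inv_INR_small (e / 2)) as [N HN]; [lra|].
    destruct (Hz (e / 2 / D)) with (N := N) as (n & Hn' & Hnz).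
    { apply Rdiv_lt_0_compat; lra. }
    specialize (HN n Hn'). destruct (Hu' n) as [_ U2].
    assert (ET : T (u n ⊖ z) = T (u n) ⊖ T z).
    { unfold hsub. replace (hs_opp X z) with ((-1) ⊙ z) by vec.
      rewrite Tadd, Tscal. vec. }
    replace (z ⊖ lam ⊙ T z)
      with ((u n ⊖ lam ⊙ T (u n)) ⊖ ((u n ⊖ z) ⊖ lam ⊙ T (u n ⊖ z))) by (rewrite ET; vec).
    set (h := u n ⊖ z) in *.
    assert (Hh : ⟦h ⊖ lam ⊙ T h⟧ <= D * ⟦h⟧).
    { eapply Rle_trans; [apply norm_sub_le|]. rewrite norm_scal. unfold D.
      specialize (HTC h). pose proof (norm_nonneg h). pose proof (norm_nonneg (T h)).
      pose proof (Rabs_pos lam). nra. }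
    assert (D * ⟦h⟧ <= e / 2).
    { apply Rle_trans with (D * (e / 2 / D)); [apply Rmult_le_compat_l; lra|].
      right. field. lra. }
    eapply Rle_trans; [apply norm_sub_le|]. lra. }
  destruct (Hz (1 / 2) ltac:(lra) 0%nat) as (n & _ & Hnz). destruct (Hu' n) as [U1 _].
  pose proof (norm_le_dist (u n) z). rewrite Hz0, norm_zero, <- Hz0 in *. lra.
Qed.

(** With [B = I - lam T] and [q = ⟪B y, y⟫], Cauchy-Schwarz for the form of [B] gives
    [⟦B y⟧ ^ 2 <= D * q], where [D] bounds the norm of [B]; the left side is at least
    [c ^ 2 * ⟦y⟧ ^ 2]. *)
Lemma psd_bounded_below_coercive {X : HilbertSpace} (T : X -> X) (lam c : R) :
  bounded_linear X T -> (forall y z, ⟪T y, z⟫ = ⟪T z, y⟫) ->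
  0 < c -> (forall y, c * ⟦y⟧ <= ⟦y ⊖ lam ⊙ T y⟧) ->
  (forall y, lam * ⟪T y, y⟫ <= ⟦y⟧ ^ 2) ->
  exists k, 0 < k /\ forall y, lam * ⟪T y, y⟫ + k * ⟦y⟧ ^ 2 <= ⟦y⟧ ^ 2.
Proof.
  intros HT Hsym Hc Hbelow Hpsd. destruct (bounded_linear_bound T HT) as (C & HC & HTC).
  destruct HT as (Tadd & Tscal & _).
  set (D := 1 + (Rabs lam + 1) * C). pose proof (Rabs_pos lam).
  assert (HD : 0 < D) by (unfold D; nra).
  exists (c ^ 2 / D). split; [apply Rdiv_lt_0_compat; nra|]. intros y.
  set (B := fun y => y ⊖ lam ⊙ T y).
  assert (Hpos : forall y, 0 <= ⟪B y, y⟫).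
  { intros w. unfold B. specialize (Hpsd w). inner_simpl. rewrite norm_sq in Hpsd. lra. }
  set (w := B y). set (q := ⟪B y, y⟫).
  assert (Hw : ⟪B w, w⟫ <= D * ⟦w⟧ ^ 2).
  { eapply Rle_trans; [apply inner_le|].
    assert (⟦B w⟧ <= D * ⟦w⟧).
    { unfold B. eapply Rle_trans; [apply norm_sub_le|]. rewrite norm_scal. unfold D.
      specialize (HTC w). pose proof (norm_nonneg w). pose proof (norm_nonneg (T w)). nra. }
    pose proof (norm_nonneg w). nra. }
  (* Cauchy-Schwarz for the form [⟪B ., .⟫] at the pair [y, B y]. *)
  assert (Hcs : (⟦w⟧ ^ 2) ^ 2 <= q * ⟪B w, w⟫).
  { apply quadratic_nonneg_discr; [apply Hpos|]. intros t.
    replace (q + 2 * ⟦w⟧ ^ 2 * t + ⟪B w, w⟫ * t ^ 2) with ⟪B (y ⊕ t ⊙ w), y ⊕ t ⊙ w⟫;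
      [apply Hpos|].
    rewrite norm_sq.
    replace (B (y ⊕ t ⊙ w)) with (w ⊕ t ⊙ B w).
    2: { unfold w, B. rewrite Tadd, Tscal. vec. }
    assert (E : ⟪B w, y⟫ = ⟪w, w⟫).
    { unfold w at 3. unfold B. inner_simpl. rewrite (Hsym w y), (hs_inner_sym _ w y),
        (hs_inner_sym _ w (T y)). ring. }
    unfold q. fold w. inner_simpl. rewrite E. ring. }
  specialize (Hbelow y). fold (B y) in Hbelow. fold w in Hbelow.
  assert (Hq : lam * ⟪T y, y⟫ = ⟦y⟧ ^ 2 - q).
  { unfold q, B. rewrite norm_sq. inner_simpl. ring. }
  rewrite Hq. pose proof (norm_nonneg y). pose proof (norm_nonneg w).
  assert (Hq0 : 0 <= q) by apply Hpos.
  set (n := ⟦w⟧ ^ 2) in *. assert (Hn : 0 <= n) by apply pow2_ge_0.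
  assert (Hnq : n <= D * q).
  { destruct Hn as [Hn|<-]; [|nra]. apply (Rmult_le_reg_r n); [exact Hn|].
    apply Rle_trans with (q * ⟪B w, w⟫); nra. }
  assert (Hcn : c ^ 2 * ⟦y⟧ ^ 2 <= n).
  { unfold n. rewrite <- Rpow_mult_distr. apply pow_incr. nra. }
  assert (c ^ 2 / D * ⟦y⟧ ^ 2 <= q); [|lra].
  apply (Rmult_le_reg_l D); [exact HD|].
  replace (D * (c ^ 2 / D * ⟦y⟧ ^ 2)) with (c ^ 2 * ⟦y⟧ ^ 2) by (field; lra). lra.
Qed.

(* [I - lam J''(x)] is positive semidefinite. *)
Definition psd_at {X : HilbertSpace} (J'' : X -> X -> X) (lam : R) (x : X) : Prop :=
  forall y, lam * ⟪J'' x y, y⟫ <= ⟦y⟧ ^ 2.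

Definition norm_continuous {X : HilbertSpace} (J'' : X -> X -> X) : Prop :=
  forall x e, 0 < e -> exists d, 0 < d /\ forall z, ⟦z ⊖ x⟧ < d ->
    forall y, ⟦J'' z y ⊖ J'' x y⟧ <= e * ⟦y⟧.

Lemma psd_at_perturb {X : HilbertSpace} (J'' : X -> X -> X) (lam k : R) (x : X) :
  norm_continuous J'' -> 0 < lam -> 0 < k ->
  exists d, 0 < d /\ forall z, ⟦z ⊖ x⟧ < d -> forall y,
    Rabs (lam * ⟪J'' z y, y⟫ - lam * ⟪J'' x y, y⟫) <= k * ⟦y⟧ ^ 2.
Proof.
  intros HJ Hlam Hk. destruct (HJ x (k / lam)) as (d & Hd & H);
    [apply Rdiv_lt_0_compat; lra|].
  exists d. split; [exact Hd|]. intros z Hz y. specialize (H z Hz y).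
  rewrite <- Rmult_minus_distr_l, <- inner_sub_l, Rabs_mult, (Rabs_pos_eq lam) by lra.
  pose proof (cauchy_schwarz (J'' z y ⊖ J'' x y) y). pose proof (norm_nonneg y).
  apply Rle_trans with (lam * (k / lam * ⟦y⟧ * ⟦y⟧)); [|right; field; lra].
  apply Rmult_le_compat_l; nra.
Qed.

Lemma psd_at_closed {X : HilbertSpace} (J'' : X -> X -> X) (lam : R) (x : X) :
  norm_continuous J'' -> 0 < lam ->
  (forall d, 0 < d -> exists z, ⟦z ⊖ x⟧ < d /\ psd_at J'' lam z) -> psd_at J'' lam x.
Proof.
  intros HJ Hlam H y. apply Rle_plus_epsilon. intros e He.
  pose proof (pow2_ge_0 ⟦y⟧).
  assert (Hk : 0 < e / (⟦y⟧ ^ 2 + 1)) by (apply Rdiv_lt_0_compat; lra).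
  destruct (psd_at_perturb J'' lam _ x HJ Hlam Hk) as (d & Hd & Hz).
  destruct (H d Hd) as (z & Hzx & Hpsd). specialize (Hz z Hzx y). specialize (Hpsd y).
  rewrite Rabs_minus_sym in Hz. eapply Rle_trans in Hz; [|apply Rle_abs].
  assert (e / (⟦y⟧ ^ 2 + 1) * ⟦y⟧ ^ 2 <= e).
  { replace (e / (⟦y⟧ ^ 2 + 1) * ⟦y⟧ ^ 2) with (e - e / (⟦y⟧ ^ 2 + 1)) by (field; lra). lra. }
  lra.
Qed.

(** If [z] near [x] had a kernel vector [y], then [y - lam J''(x) y = lam (J''(z) y - J''(x) y)]
    would have norm at most [c / 2 * ⟦y⟧], against the lower bound at [x]. *)
Lemma A_set_closed {X : HilbertSpace} (J'' : X -> X -> X) (lam : R) :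
  norm_continuous J'' -> 0 < lam ->
  (forall x, ~ A_set X J'' lam x ->
     exists c, 0 < c /\ forall y, c * ⟦y⟧ <= ⟦y ⊖ lam ⊙ J'' x y⟧) ->
  is_closed X (A_set X J'' lam).
Proof.
  intros HJ Hlam Hbelow x Hx. destruct (Hbelow x Hx) as (c & Hc & Hcx).
  destruct (HJ x (c / 2 / lam)) as (d & Hd & H).
  { repeat apply Rdiv_lt_0_compat; lra. }
  exists d. split; [exact Hd|]. intros z Hz (y & Hy & E).
  specialize (H z Hz y). specialize (Hcx y). pose proof (norm_pos y Hy).
  rewrite E in Hcx at 2.
  replace (lam ⊙ J'' z y ⊖ lam ⊙ J'' x y) with (lam ⊙ (J'' z y ⊖ J'' x y)) in Hcx by vec.
  rewrite norm_scal, Rabs_pos_eq in Hcx by lra.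
  apply (Rmult_le_compat_l lam) in H; [|lra].
  replace (lam * (c / 2 / lam * ⟦y⟧)) with (c / 2 * ⟦y⟧) in H by (field; lra). nra.
Qed.

(** Connectedness of the interval: at the supremum of the parameters up to which [Q] holds,
    closedness gives [Q], and openness carries it further unless the parameter is 1. The end [b] is
    reached by closedness alone, so it may lie in [S]. *)
Lemma segment_propagation {X : HilbertSpace} (S Q : X -> Prop) (a b : X) :
  Q a -> (forall t, 0 <= t < 1 -> ~ S (a ⊕ t ⊙ (b ⊖ a))) ->
  (forall x, Q x -> ~ S x -> exists d, 0 < d /\ forall z, ⟦z ⊖ x⟧ < d -> Q z) ->
  (forall x, (forall d, 0 < d -> exists z, ⟦z ⊖ x⟧ < d /\ Q z) -> Q x) ->
  Q b.
Proof.
  intros Ha HS Hopen Hclosed. set (p := fun t => a ⊕ t ⊙ (b ⊖ a)).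
  set (E := fun t => 0 <= t <= 1 /\ forall s, 0 <= s <= t -> Q (p s)).
  assert (E0 : E 0).
  { split; [lra|]. intros s Hs. replace s with 0 by lra.
    unfold p. replace (a ⊕ 0 ⊙ (b ⊖ a)) with a by vec. exact Ha. }
  destruct (completeness E) as [t [Hub Hlub]]; [exists 1; intros t [Ht _]; lra|eauto|].
  assert (Ht : 0 <= t <= 1) by (split; [apply Hub, E0|apply Hlub; intros s [Hs _]; lra]).
  pose proof (norm_nonneg (b ⊖ a)) as HN. set (L := ⟦b ⊖ a⟧ + 1).
  assert (Hp : forall s s', ⟦p s ⊖ p s'⟧ <= Rabs (s - s') * L).
  { intros s s'. unfold p, L.
    replace (a ⊕ s ⊙ (b ⊖ a) ⊖ (a ⊕ s' ⊙ (b ⊖ a))) with ((s - s') ⊙ (b ⊖ a)) by vec.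
    rewrite norm_scal. pose proof (Rabs_pos (s - s')). nra. }
  assert (Hlt : forall s, 0 <= s < t -> Q (p s)).
  { intros s Hs. apply NNPP. intros Hq. assert (t <= s); [|lra].
    apply Hlub. intros t' [Ht' H']. apply Rnot_lt_le. intros Hlt. apply Hq, H'. lra. }
  assert (Hd : forall d, 0 < d -> 0 < d / 2 / L)
    by (intros; repeat apply Rdiv_lt_0_compat; unfold L; lra).
  assert (HdL : forall d, d / 2 / L * L = d / 2) by (intros; unfold L; field; lra).
  assert (Hqt : Q (p t)).
  { destruct (proj1 Ht) as [Ht0|<-]; [|apply E0; lra].
    apply Hclosed. intros d Hd0. pose proof (Hd d Hd0) as Hd'.
    set (s := Rmax 0 (t - d / 2 / L)).
    assert (Hs : 0 <= s < t) by (unfold s; split; [apply Rmax_l|apply Rmax_lub_lt; lra]).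
    exists (p s). split; [|apply Hlt, Hs].
    eapply Rle_lt_trans; [apply Hp|].
    assert (Rabs (s - t) <= d / 2 / L).
    { rewrite Rabs_left1 by lra. pose proof (Rmax_r 0 (t - d / 2 / L)) as M0. fold s in M0. lra. }
    apply Rle_lt_trans with (d / 2 / L * L); [apply Rmult_le_compat_r; [unfold L|]; lra|].
    rewrite HdL. lra. }
  destruct (proj2 Ht) as [Ht1| ->].
  - exfalso. destruct (Hopen (p t) Hqt) as (d & Hd0 & Hz); [apply HS; lra|].
    pose proof (Hd d Hd0) as Hd'.
    set (t' := Rmin 1 (t + d / 2 / L)).
    assert (Ht' : t < t') by (unfold t'; apply Rmin_glb_lt; lra).
    pose proof (Rmin_l 1 (t + d / 2 / L)) as M1. pose proof (Rmin_r 1 (t + d / 2 / L)) as M2.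
    fold t' in M1, M2.
    assert (t' <= t); [|lra]. apply Hub. split; [lra|]. intros s Hs.
    destruct (Rlt_or_le s t) as [L1|L1]; [apply Hlt; lra|].
    apply Hz. eapply Rle_lt_trans; [apply Hp|]. rewrite Rabs_pos_eq by lra.
    apply Rle_lt_trans with (d / 2 / L * L); [apply Rmult_le_compat_r; [unfold L|]; lra|].
    rewrite HdL. lra.
  - unfold p in Hqt. replace (a ⊕ 1 ⊙ (b ⊖ a)) with b in Hqt by vec. exact Hqt.
Qed.

(** * Minimizers of the perturbed energy *)

Definition energy {X : HilbertSpace} (lam : R) (J : X -> R) (v x : X) : R :=
  ⟪x, x⟫ / 2 - lam * J x - ⟪v, x⟫.

Definition energy_gradient {X : HilbertSpace} (lam : R) (J' : X -> X) (v x : X) : X :=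
  x ⊖ lam ⊙ J' x ⊖ v.

Lemma energy_has_gradient {X : HilbertSpace} (lam : R) (J : X -> R) J' (v : X) :
  0 < lam -> has_gradient J J' -> has_gradient (energy lam J v) (energy_gradient lam J' v).
Proof.
  intros Hlam HJ x e He.
  destruct (HJ x (e / 2 / lam)) as (d & Hd & H); [repeat apply Rdiv_lt_0_compat; lra|].
  (* The bound [⟦h⟧ < e] makes the quadratic remainder [⟦h⟧ ^ 2 / 2] at most [e / 2 * ⟦h⟧]. *)
  exists (Rmin d e). split; [apply Rmin_pos; auto|]. intros h Hh.
  pose proof (Rmin_l d e). pose proof (Rmin_r d e). specialize (H h ltac:(lra)).
  unfold energy, energy_gradient.
  set (D := J (x ⊕ h) - J x - ⟪J' x, h⟫) in *.
  match goal with |- Rabs ?a <= _ => replace a with (⟦h⟧ ^ 2 / 2 + lam * - D) end.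
  2: { unfold D. rewrite norm_sq. inner_simpl. rewrite (hs_inner_sym _ h x). field. }
  eapply Rle_trans; [apply Rabs_triang|].
  pose proof (norm_nonneg h). pose proof (pow2_ge_0 ⟦h⟧).
  rewrite Rabs_mult, Rabs_Ropp, (Rabs_pos_eq lam), Rabs_pos_eq by lra.
  apply (Rmult_le_compat_l lam) in H; [|lra].
  replace (lam * (e / 2 / lam * ⟦h⟧)) with (e / 2 * ⟦h⟧) in H by (field; lra). nra.
Qed.

Lemma energy_gradient_has_derivative {X : HilbertSpace} (lam : R) (J' T : X -> X) (v x : X) :
  0 < lam -> has_derivative_at J' T x ->
  has_derivative_at (energy_gradient lam J' v) (fun y => y ⊖ lam ⊙ T y) x.
Proof.
  intros Hlam HT e He. destruct (HT (e / lam)) as (d & Hd & H);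
    [apply Rdiv_lt_0_compat; lra|].
  exists d. split; [exact Hd|]. intros h Hh. specialize (H h Hh). unfold energy_gradient.
  match goal with |- ⟦?a⟧ <= _ =>
    replace a with (- lam ⊙ (J' (x ⊕ h) ⊖ J' x ⊖ T h)) by vec end.
  rewrite norm_scal, Rabs_Ropp, Rabs_pos_eq by lra.
  apply (Rmult_le_compat_l lam) in H; [|lra].
  replace (lam * (e / lam * ⟦h⟧)) with (e * ⟦h⟧) in H by (field; lra). exact H.
Qed.

Lemma identity_minus_bounded_linear {X : HilbertSpace} (lam : R) (T : X -> X) :
  bounded_linear X T -> bounded_linear X (fun y => y ⊖ lam ⊙ T y).
Proof.
  intros HT. destruct (bounded_linear_bound T HT) as (C & HC & HTC).
  destruct HT as (Tadd & Tscal & _). split; [|split].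
  - intros x y. rewrite Tadd. vec.
  - intros a x. rewrite Tscal. vec.
  - exists (1 + Rabs lam * C). intros y. eapply Rle_trans; [apply norm_sub_le|].
    rewrite norm_scal. specialize (HTC y). pose proof (Rabs_pos lam). nra.
Qed.

(** Outside a ball the growth bound leaves a quadratic in [⟦x⟧] with leading coefficient
    [d / 2 > 0], bounded by completing the square. Inside, [J'] is bounded, hence so is [J] by the
    mean value theorem. *)
Lemma energy_bounded_below {X : HilbertSpace} (lam : R) (J : X -> R) J' (v : X) :
  0 < lam -> has_gradient J J' -> compact_on_balls J' ->
  limsup_infty_lt X (fun x => 2 * (J x / ⟦x⟧ ^ 2)) (/ lam) ->
  exists m, forall x, m <= energy lam J v x.
Proof.
  intros Hlam HJ HK (c & Hc & r & Hr).
  (* Taking the radius nonnegative ensures [⟦x⟧ > 0] outside the ball, so that the quotient can be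
     cleared. *)
  set (r0 := Rmax r 0). pose proof (Rmax_l r 0) as Hr1. pose proof (Rmax_r r 0) as Hr2.
  fold r0 in Hr1, Hr2.
  destruct (totally_bounded_bounded _ (HK r0)) as [C HC].
  set (d := 1 - lam * c).
  assert (Hd : 0 < d).
  { unfold d. apply (Rmult_lt_compat_l lam) in Hc; [|lra]. rewrite Rinv_r in Hc; lra. }
  set (V := ⟦v⟧). assert (HV : 0 <= V) by apply norm_nonneg.
  exists (Rmin (- (V ^ 2 / (2 * d))) (- (lam * (J (hs_zero X) + Rabs C * r0)) - V * r0)).
  intros x. pose proof (norm_nonneg x) as Hx0. unfold energy.
  pose proof (inner_le v x) as Hvx. fold V in Hvx. rewrite <- norm_sq.
  destruct (Rlt_or_le r0 ⟦x⟧) as [Hx|Hx].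
  - eapply Rle_trans; [apply Rmin_l|]. specialize (Hr x ltac:(lra)).
    assert (HJx : 2 * J x <= c * ⟦x⟧ ^ 2).
    { apply (Rmult_le_compat_r (⟦x⟧ ^ 2)) in Hr; [|apply pow2_ge_0].
      replace (2 * (J x / ⟦x⟧ ^ 2) * ⟦x⟧ ^ 2) with (2 * J x) in Hr by (field; lra). exact Hr. }
    assert (lam * J x <= (1 - d) / 2 * ⟦x⟧ ^ 2) by (unfold d; nra).
    assert (Hsq : 0 <= (d * ⟦x⟧ - V) ^ 2 / (2 * d)).
    { apply Rmult_le_pos; [apply pow2_ge_0|]. apply Rlt_le, Rinv_0_lt_compat. lra. }
    replace ((d * ⟦x⟧ - V) ^ 2 / (2 * d))
      with (d / 2 * ⟦x⟧ ^ 2 - V * ⟦x⟧ + V ^ 2 / (2 * d)) in Hsq by (field; lra). lra.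
  - eapply Rle_trans; [apply Rmin_r|].
    destruct (has_gradient_mean_value J J' (hs_zero X) x HJ) as (t & Ht & E).
    replace (hs_zero X ⊕ x) with x in E by vec.
    replace (hs_zero X ⊕ t ⊙ x) with (t ⊙ x) in E by vec.
    assert (HCx : ⟦J' (t ⊙ x)⟧ <= C).
    { apply HC. exists (t ⊙ x). split; [|reflexivity].
      rewrite norm_scal, Rabs_pos_eq; nra. }
    pose proof (inner_le (J' (t ⊙ x)) x) as Hin. pose proof (Rle_abs C).
    pose proof (norm_nonneg (J' (t ⊙ x))).
    assert (Hb : ⟦J' (t ⊙ x)⟧ * ⟦x⟧ <= Rabs C * r0) by (apply Rmult_le_compat; lra).
    assert (V * ⟦x⟧ <= V * r0) by (apply Rmult_le_compat_l; lra).
    assert (lam * J x <= lam * (J (hs_zero X) + Rabs C * r0))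
      by (apply Rmult_le_compat_l; lra).
    pose proof (pow2_ge_0 ⟦x⟧). lra.
Qed.

(** Pairing the gradient with [x] gives [d * ⟦x⟧ ^ 2 <= (1 + ⟦v⟧) * ⟦x⟧] outside a ball. This bounds
    Palais-Smale sequences. *)
Lemma energy_gradient_coercive {X : HilbertSpace} (lam : R) (J' : X -> X) (v : X) :
  0 < lam ->
  limsup_infty_lt X (fun x => ⟪J' x, x⟫ / ⟦x⟧ ^ 2) (/ lam) ->
  exists R0, forall x, ⟦energy_gradient lam J' v x⟧ <= 1 -> ⟦x⟧ <= R0.
Proof.
  intros Hlam (c & Hc & r & Hr).
  set (r0 := Rmax r 0). pose proof (Rmax_l r 0) as Hr1. pose proof (Rmax_r r 0) as Hr2.
  fold r0 in Hr1, Hr2. set (d := 1 - lam * c).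
  assert (Hd : 0 < d).
  { unfold d. apply (Rmult_lt_compat_l lam) in Hc; [|lra]. rewrite Rinv_r in Hc; lra. }
  exists (Rmax r0 ((1 + ⟦v⟧) / d)). intros x Hx.
  destruct (Rle_or_lt ⟦x⟧ r0) as [L|L]; [eapply Rle_trans; [exact L|apply Rmax_l]|].
  eapply Rle_trans; [|apply Rmax_r]. specialize (Hr x ltac:(lra)).
  assert (HJx : ⟪J' x, x⟫ <= c * ⟦x⟧ ^ 2).
  { apply (Rmult_le_compat_r (⟦x⟧ ^ 2)) in Hr; [|apply pow2_ge_0].
    replace (⟪J' x, x⟫ / ⟦x⟧ ^ 2 * ⟦x⟧ ^ 2) with ⟪J' x, x⟫ in Hr by (field; lra). exact Hr. }
  pose proof (inner_le (energy_gradient lam J' v x) x) as H1.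
  pose proof (inner_le v x) as H2.
  assert (E : ⟪energy_gradient lam J' v x, x⟫ = ⟦x⟧ ^ 2 - lam * ⟪J' x, x⟫ - ⟪v, x⟫)
    by (unfold energy_gradient; rewrite norm_sq; inner_simpl; ring).
  assert (lam * ⟪J' x, x⟫ <= (1 - d) * ⟦x⟧ ^ 2) by (unfold d; nra).
  assert (d * ⟦x⟧ ^ 2 <= (1 + ⟦v⟧) * ⟦x⟧) by nra.
  apply (Rmult_le_reg_l d); [exact Hd|].
  replace (d * ((1 + ⟦v⟧) / d)) with (1 + ⟦v⟧) by (field; lra). nra.
Qed.

Lemma energy_minimizer {X : HilbertSpace} (lam : R) (J : X -> R) J' (v : X) :
  0 < lam -> has_gradient J J' -> compact_on_balls J' ->
  limsup_infty_lt X (fun x => 2 * (J x / ⟦x⟧ ^ 2)) (/ lam) ->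
  limsup_infty_lt X (fun x => ⟪J' x, x⟫ / ⟦x⟧ ^ 2) (/ lam) ->
  exists p, forall z, energy lam J v p <= energy lam J v z.
Proof.
  intros Hlam HJ HK Hlim1 Hlim2.
  destruct (energy_bounded_below lam J J' v Hlam HJ HK Hlim1) as [m Hm].
  destruct (energy_gradient_coercive lam J' v Hlam Hlim2) as [R0 HR0].
  pose proof (energy_has_gradient lam J J' v Hlam HJ) as Hg.
  pose proof (has_gradient_continuous _ _ Hg) as Hcont.
  assert (Hps : forall n, exists x, ⟦energy_gradient lam J' v x⟧ <= / INR (S n) /\
    forall z, energy lam J v x <= energy lam J v z + / INR (S n)).
  { intros n. pose proof (inv_INR_pos n) as He.
    destruct (near_minimizer (fun _ => True) (energy lam J v) m) with (e := / INR (S n))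
      as (x0 & _ & Hx0); auto; [exists (hs_zero X); auto|].
    destruct (ekeland (energy lam J v) m (/ INR (S n)) x0) as (x & Hx & Hxz); auto.
    exists x. split.
    - apply (gradient_bound (energy lam J v)); auto. lra.
    - intros z. specialize (Hx0 z I). lra. }
  destruct (choice _ Hps) as [u Hu].
  assert (HuR : forall n, ⟦u n⟧ <= R0).
  { intros n. apply HR0. destruct (Hu n) as [H _]. eapply Rle_trans; [exact H|].
    rewrite <- Rinv_1. apply Rinv_le_contravar; [lra|]. apply (le_INR 1). lia. }
  destruct (cluster_point u) as [p Hp].
  { intros e He. destruct (inv_INR_small (e / 2)) as [N HN]; [lra|].
    destruct (HK R0 (e / 2 / lam)) as [l Hl]; [repeat apply Rdiv_lt_0_compat; lra|].
    exists N, (map (fun c => v ⊕ lam ⊙ c) l). intros n Hn. specialize (HN n Hn).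
    destruct (Hu n) as [H _].
    destruct (Hl (J' (u n))) as (c & Hc & Hcd); [exists (u n); auto|].
    (* Since [u n] is its energy gradient plus [v ⊕ lam ⊙ J' (u n)], it is as close to this centre
       as the small gradient and the cover of the range of [J'] permit. *)
    exists (v ⊕ lam ⊙ c). split; [apply in_map_iff; eauto|].
    replace (u n ⊖ (v ⊕ lam ⊙ c))
      with (energy_gradient lam J' v (u n) ⊕ lam ⊙ (J' (u n) ⊖ c))
      by (unfold energy_gradient; vec).
    eapply Rle_lt_trans; [apply norm_triangle|].
    rewrite norm_scal, Rabs_pos_eq by lra.
    apply (Rmult_lt_compat_l lam) in Hcd; [|lra].
    replace (lam * (e / 2 / lam)) with (e / 2) in Hcd by (field; lra). lra. }
  exists p. intros z. apply Rle_plus_epsilon. intros e He.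
  destruct (Hcont p (e / 2)) as (d & Hd & Hc); [lra|].
  destruct (inv_INR_small (e / 2)) as [N HN]; [lra|].
  destruct (Hp d Hd N) as (n & Hn & Hnp). specialize (HN n Hn).
  specialize (Hc (u n) Hnp). apply Rabs_def2 in Hc. destruct (Hu n) as [_ H].
  specialize (H z). lra.
Qed.

Theorem theorem2 (X : HilbertSpace) (J : X -> R) (J' : X -> X) (J'' : X -> X -> X) :
  infinite_dim X ->
  is_C2 X J J' J'' ->
  compact_operator X J' ->
  (* M < sup_{x, y<>0} <J''(x)y,y>/||y||^2 *)
  (exists x y, y <> hs_zero X /\
     M_lt X J J' (hs_inner X (J'' x y) y / (hnorm X y) ^ 2)) ->
  forall lam : R,
    (* inf_{<J''(x)y,y> > 0} ||y||^2/<J''(x)y,y> < lam *)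
    (exists x y, 0 < hs_inner X (J'' x y) y /\
       (hnorm X y) ^ 2 / hs_inner X (J'' x y) y < lam) ->
    (* lam < 1/M  (equivalently M < 1/lam, as lam > 0) *)
    M_lt X J J' (/ lam) ->
    is_closed X (A_set X J'' lam) /\ ~ sigma_compact X (A_set X J'' lam).
Proof.
  intros HX (HJ & Hlin & Hder & Hcont) [HJ'cont HJ'comp] _ lam
    (q & y & Hy & Hqy) (Hlam & Hlim1 & Hlim2).
  apply Rinv_0_lt_compat in Hlam. rewrite Rinv_inv in Hlam.
  assert (HK : compact_on_balls J').
  { intros r. apply rel_compact_totally_bounded, HJ'comp. exists r. auto. }
  assert (Hbelow : forall x, ~ A_set X J'' lam x ->
     exists c, 0 < c /\ forall y, c * ⟦y⟧ <= ⟦y ⊖ lam ⊙ J'' x y⟧).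
  { intros x Hx. apply injective_bounded_below; [apply Hlin| |].
    - apply (derivative_compact J' (J'' x) x); auto. exact (Hder x).
    - intros w Hw. apply NNPP. intros Hw0. apply Hx. exists w. auto. }
  split; [apply A_set_closed; auto|]. intros (K & HKc & HKA).
  (* This [v] is a regular value of [x ⊖ lam ⊙ J' x]: no critical point of the energy shifted by [v]
     lies in the singular set. *)
  destruct (thin_union_not_full
              (fun n => image X (fun x => x ⊖ lam ⊙ J' x) (K n)) HX) as [v Hv].
  { intros n. apply totally_bounded_thin, compact_image_totally_bounded; auto.
    intros x e He. destruct (HJ'cont x (e / 2 / lam)) as (d & Hd & H);
      [repeat apply Rdiv_lt_0_compat; lra|].
    exists (Rmin d (e / 2)). split; [apply Rmin_pos; lra|]. intros z Hz.
    pose proof (Rmin_l d (e / 2)). pose proof (Rmin_r d (e / 2)).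
    specialize (H z ltac:(lra)).
    replace (z ⊖ lam ⊙ J' z ⊖ (x ⊖ lam ⊙ J' x))
      with ((z ⊖ x) ⊖ lam ⊙ (J' z ⊖ J' x)) by vec.
    eapply Rle_lt_trans; [apply norm_sub_le|]. rewrite norm_scal, Rabs_pos_eq by lra.
    apply (Rmult_lt_compat_l lam) in H; [|lra].
    replace (lam * (e / 2 / lam)) with (e / 2) in H by (field; lra). lra. }
  destruct (energy_minimizer lam J J' v Hlam HJ HK Hlim1 Hlim2) as [p Hp].
  pose proof (energy_has_gradient lam J J' v Hlam HJ) as Hgrad.
  assert (HpA : ~ A_set X J'' lam p).
  { intros HA. apply HKA in HA. destruct HA as [n Hn]. apply (Hv n). exists p.
    split; [exact Hn|].
    assert (E : energy_gradient lam J' v p = hs_zero X).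
    { apply norm_eq_zero, Rle_antisym; [|apply norm_nonneg].
      apply (gradient_bound _ _ _ 0 Hgrad); [lra|]. intros z. specialize (Hp z). lra. }
    unfold energy_gradient in E. apply inner_ext. intros w.
    apply Rminus_diag_uniq. rewrite <- inner_sub_l, E. apply inner_zero_l. }
  assert (Hpsd : psd_at J'' lam p).
  { intros w.
    pose proof (second_order_condition _ _ (fun y => y ⊖ lam ⊙ J'' p y) p Hgrad
      (identity_minus_bounded_linear lam (J'' p) (Hlin p))
      (energy_gradient_has_derivative lam J' (J'' p) v p Hlam (Hder p)) Hp w) as H.
    cbv beta in H. revert H. inner_simpl. rewrite norm_sq. lra. }
  assert (Hopen : forall x, psd_at J'' lam x -> ~ A_set X J'' lam x ->
    exists d, 0 < d /\ forall z, ⟦z ⊖ x⟧ < d -> psd_at J'' lam z).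
  { intros x Hx HA. destruct (Hbelow x HA) as (c & Hc & Hcx).
    destruct (psd_bounded_below_coercive (J'' x) lam c) as (k & Hk & Hkx); auto.
    { apply (hessian_symmetric J J' (J'' x) x); auto. exact (Hder x). }
    destruct (psd_at_perturb J'' lam k x Hcont Hlam Hk) as (d & Hd & H).
    exists d. split; [exact Hd|]. intros z Hz w. specialize (H z Hz w). specialize (Hkx w).
    eapply Rle_trans in H; [|apply Rle_abs]. lra. }
  assert (Hclosed : forall x,
    (forall d, 0 < d -> exists z, ⟦z ⊖ x⟧ < d /\ psd_at J'' lam z) -> psd_at J'' lam x)
    by (intros; apply psd_at_closed; auto).
  (* The point [z] sees both [p] and [q] along segments that meet the singular set at most at those
     two ends. *)
  destruct (segments_avoid K p q HX) as [z Hz].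
  { intros n. apply totally_bounded_thin, compact_totally_bounded, HKc. }
  assert (HzA : forall a, a = p \/ a = q -> forall t, 0 < t <= 1 ->
    ~ A_set X J'' lam (a ⊕ t ⊙ (z ⊖ a))).
  { intros a Ha t Ht HA. apply HKA in HA. destruct HA as [n Hn].
    apply (Hz a Ha t Ht n Hn). }
  assert (Hpsdz : psd_at J'' lam z).
  { apply (segment_propagation (A_set X J'' lam) _ p z); auto.
    intros t Ht. destruct (proj1 Ht) as [Ht0|<-]; [apply HzA; auto; lra|].
    replace (p ⊕ 0 ⊙ (z ⊖ p)) with p by vec. exact HpA. }
  assert (Hpsdq : psd_at J'' lam q).
  { apply (segment_propagation (A_set X J'' lam) _ z q); auto.
    (* Read backwards from [q], the parameter [1 - t] is positive for [t < 1], so only the endpoint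
       [q] itself can be singular. *)
    intros t Ht. replace (z ⊕ t ⊙ (q ⊖ z)) with (q ⊕ (1 - t) ⊙ (z ⊖ q)) by vec.
    apply HzA; auto. lra. }
  (* Semidefiniteness at [q] contradicts the choice of [q] and [y], for which
     [⟦y⟧ ^ 2 < lam * ⟪J'' q y, y⟫]. *)
  specialize (Hpsdq y). apply (Rmult_lt_compat_r _ _ _ Hy) in Hqy.
  unfold Rdiv in Hqy. rewrite Rmult_assoc, Rinv_l in Hqy by lra. lra.
Qed.
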